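(* Let $A$ generate a $C_0$-semigroup $(T(t))_{t\ge 0}$ on a Banach space $X$, let $U$ be a Banach space and $B\in \mathcal{L}(U,X_{-1})$. Suppose that $(T(t))_{t\ge 0}$ is exponentially stable and analytic, and let $p\in[1,\infty]$. Then $\Sigma(A,B)$ is finite-time $L^p$-$L^p$-admissible if and only if $\Sigma(A,B)$ is infinite-time $L^p$-$L^p$-admissible.
   Context: For a $C_0$-semigroup $(T(t))_{t\ge0}$ with generator $A$ on a Banach space $X$, the extrapolation space $X_{-1}$ is the completion of $X$ with respect to $\|x\|_{-1}:=\|(\lambda-A)^{-1}x\|$ for a fixed $\lambda\in\rho(A)$ (different choices give equivalent norms). The semigroup extends uniquely to a $C_0$-semigroup $(T_{-1}(t))_{t\ge0}$ on $X_{-1}$, whose generator $A_{-1}$ extends $A$ and has domain $X$. For $B\in\mathcal{L}(U,X_{-1})$, $\Sigma(A,B)$ denotes the system $\dot x(t)=Ax(t)+Bu(t)$, $t\ge0$, $x(0)=x_0$. For $\tau\ge0$ and $u\in L^p([0,\tau],U)$ put $\Phi_\tau u:=\int_0^\tau T_{-1}(\tau-s)Bu(s)\,ds\in X_{-1}$. $(T(t))_{t\ge0}$ is exponentially stable if there are $M,\omega>0$ with $\|T(t)\|\le Me^{-\omega t}$ for all $t\ge0$. For $p,q\in[1,\infty]$, $\Sigma(A,B)$ is (finite-time) $L^p$-$L^q$-admissible if for some (equivalently, all) $t>0$: $u\in L^p([0,t],U)$ implies $\Phi_{(\cdot)}u\in L^q([0,t],X)$. It is infinite-time $L^p$-$L^q$-admissible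 if it is $L^p$-$L^q$-admissible and there is a constant $c_\infty<\infty$ independent of $t$ such that $\|\Phi_{(\cdot)}u\|_{L^q([0,t],X)}\le c_\infty\|u\|_{L^p([0,t],U)}$ for all $t\ge 0$ and $u\in L^p([0,t],U)$. *)

(* Defs.v *)
From HB Require Import structures.
From mathcomp Require Import all_boot all_order all_algebra.
From mathcomp Require Export complex.
From mathcomp Require Export all_classical all_reals all_analysis.

Set Implicit Arguments.
Unset Strict Implicit.
Unset Printing Implicit Defensive.

Import Order.TTheory GRing.Theory Num.Theory.
Import numFieldNormedType.Exports.

Local Open Scope classical_set_scope.
Local Open Scope ring_scope.
Local Open Scope complex_scope.

(* All Banach spaces are complex.  The library's norm on a normed space over
   R[i] takes its values in R[i]; rnorm is the same norm, as an element of R. *)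
Definition rnorm {R : realType} {V : normedZmodType R[i]} (v : V) : R :=
  complex.Re `|v|.

Section Bochner.
Context {R : realType} {X : completeNormedModType R[i]}.
Let mu := @lebesgue_measure R.

Definition simple_function (s : R -> X) : Prop :=
  finite_set (range s) /\ forall v, measurable (s @^-1` [set v]).

(* Pointwise limits (on D) of Borel simple functions.  Every class, modulo
   equality almost everywhere, of Bochner-measurable functions (almost everywhere
   limits of simple functions) has such a representative, and everything below
   depends on such classes only. *)
Definition strongly_measurable (D : set R) (f : R -> X) : Prop :=
  exists2 s : nat -> R -> X, (forall n, simple_function (s n)) &
    forall x, D x -> s n x @[n --> \oo] --> f x.

(* meant for D of finite measure *)
Definition simple_integral (D : set R) (s : R -> X) : X :=
  \sum_(v \in range s) (fine (mu (D `&` s @^-1` [set v])))%:C *: v.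

Definition is_bochner_integral (D : set R) (f : R -> X) (v : X) : Prop :=
  strongly_measurable D f /\
  exists s : nat -> R -> X,
    [/\ forall n, simple_function (s n),
        (\int[mu]_(x in D) (rnorm (f x - s n x))%:E)%E @[n --> \oo]
          --> (0 : \bar R)
      & simple_integral D (s n) @[n --> \oo] --> v].

(* 0 if f is not Bochner integrable on D *)
Definition bochner_integral (D : set R) (f : R -> X) : X :=
  xget 0 [set v | is_bochner_integral D f v].

(* the norm of L^p([0,t], X), for p in [1,+oo] *)
Definition Lp_norm (p : \bar R) (t : R) (f : R -> X) : \bar R :=
  Lnorm mu p (fun s => (\1_(`[0, t]%classic) s * rnorm (f s))%:E).

Definition in_Lp (p : \bar R) (t : R) (f : R -> X) : Prop :=
  strongly_measurable `[0, t]%classic f /\ (Lp_norm p t f < +oo)%E.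

End Bochner.

Section Semigroup.
Context {R : realType} {X : completeNormedModType R[i]}.

Definition C0_semigroup (T : R -> {linear X -> X}) : Prop :=
  [/\ forall t, 0 <= t -> continuous (T t),
      forall x, T 0 x = x,
      forall s t x, 0 <= s -> 0 <= t -> T (s + t) x = T s (T t x)
    & forall x, T t x @[t --> 0^'+] --> x].

(* The values of opfun outside opdom are irrelevant. *)
Record unbounded_operator := UnboundedOperator {
  opdom : set X;
  opfun :> X -> X }.

Definition is_generator (T : R -> {linear X -> X}) (A : unbounded_operator) :
    Prop :=
  forall x y, (opdom A x /\ A x = y) <->
    (t%:C)^-1 *: (T t x - x) @[t --> 0^'+] --> y.

(* lambda belongs to the resolvent set of A and Rl = (lambda - A)^-1 *)
Definition is_resolvent (A : unbounded_operator) (lambda : R[i])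
    (Rl : {linear X -> X}) : Prop :=
  [/\ continuous Rl,
      forall x, opdom A (Rl x) /\ lambda *: Rl x - A (Rl x) = x
    & forall x, opdom A x -> Rl (lambda *: x - A x) = x].

Definition exponentially_stable (T : R -> {linear X -> X}) : Prop :=
  exists M omega : R, [/\ 0 < M, 0 < omega &
    forall t x, 0 <= t -> rnorm (T t x) <= M * expR (- omega * t) * rnorm x].

Definition sector (theta : R) : set R[i] :=
  [set z | exists r phi : R,
     [/\ 0 < r, `|phi| < theta & z = (r * cos phi) +i* (r * sin phi)]].

(* complex differentiability at z in the operator norm *)
Definition holomorphic_at (S : R[i] -> {linear X -> X}) (z : R[i]) : Prop :=
  exists2 S' : {linear X -> X}, continuous S' &
    forall eps : R, 0 < eps -> exists2 d : R, 0 < d &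
      forall (h : R[i]) (x : X), h != 0 -> rnorm h < d ->
        rnorm (h^-1 *: (S (z + h) x - S z x) - S' x) <= eps * rnorm x.

Definition analytic_semigroup (T : R -> {linear X -> X}) : Prop :=
  exists (theta : R) (S : R[i] -> {linear X -> X}),
    0 < theta <= pi / 2 /\
    [/\ forall t, 0 <= t -> S t%:C =1 T t,
        forall z, sector theta z -> continuous (S z),
        forall z w x, sector theta z -> sector theta w ->
          S (z + w) x = S z (S w x),
        forall z, sector theta z -> holomorphic_at S z
      & forall (theta' : R) (x : X), 0 < theta' < theta ->
          forall eps : R, 0 < eps -> exists2 d : R, 0 < d &
            forall z, sector theta' z -> rnorm z < d ->
              rnorm (S z x - x) < eps].

End Semigroup.

Section Extrapolation.
Context {R : realType} {X Xm1 : completeNormedModType R[i]}.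

(* Xm1 is, through j, a completion of X for the norm x |-> `|Rl x|, where
   Rl = (lambda - A)^-1, and Tm1 is the extension of T to it.  A completion is
   unique up to isometric isomorphism, and it always exists: for instance
   Xm1 = X, j = Rl, Tm1 = T is one. *)
Definition is_extrapolation (T : R -> {linear X -> X}) (Rl : {linear X -> X})
    (j : {linear X -> Xm1}) (Tm1 : R -> {linear Xm1 -> Xm1}) : Prop :=
  [/\ forall x, `|j x| = `|Rl x|,
      dense (range j),
      C0_semigroup Tm1
    & forall t x, 0 <= t -> Tm1 t (j x) = j (T t x)].

End Extrapolation.

Section Admissibility.
Context {R : realType} {X Xm1 U : completeNormedModType R[i]}.
Variables (j : {linear X -> Xm1}) (Tm1 : R -> {linear Xm1 -> Xm1}).
Variable B : {linear U -> Xm1}.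
Let mu := @lebesgue_measure R.

Definition Phi (tau : R) (u : R -> U) : Xm1 :=
  bochner_integral `[0, tau]%classic (fun s => Tm1 (tau - s) (B (u s))).

(* s |-> Phi s u is (through the embedding j, and up to equality almost
   everywhere) the element f of L^q([0,t], X) *)
Definition Phi_eq_in_Lq (q : \bar R) (t : R) (u : R -> U) (f : R -> X) : Prop :=
  in_Lp q t f /\
  {ae mu, forall s, `[0, t]%classic s -> j (f s) = Phi s u}.

Definition admissible (p q : \bar R) : Prop :=
  exists2 t : R, 0 < t &
    forall u : R -> U, in_Lp p t u -> exists f, Phi_eq_in_Lq q t u f.

Definition infinite_time_admissible (p q : \bar R) : Prop :=
  admissible p q /\
  exists c : R, forall (t : R) (u : R -> U), 0 <= t -> in_Lp p t u ->
    exists2 f, Phi_eq_in_Lq q t u f &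
      (Lp_norm q t f <= c%:E * Lp_norm p t u)%E.

End Admissibility.

(* Main.v *)
Require Import Defs.
From mathcomp Require Import all_boot all_order all_algebra.
From mathcomp Require Import complex all_classical all_reals all_analysis.
From mathcomp Require Import measurable_realfun ess_sup_inf convex.
From mathcomp Require Import interval_inference lra ring zify.
Import Order.TTheory GRing.Theory Num.Theory.
Import numFieldNormedType.Exports.
Local Open Scope classical_set_scope.
Local Open Scope ring_scope.
Local Open Scope complex_scope.
Set Implicit Arguments.
Unset Strict Implicit.
Unset Printing Implicit Defensive.

(** Only the passage from finite to infinite time needs an argument.  Write
[S] for the extrapolated semigroup and cut the time axis into blocks
[[k a, (k+1) a[].  For [tau] in the block [k] and [m = k - 1],

  [Phi tau u = S (tau - m a) (Phi (m a) u) + Phi (tau - m a) (u (. + m a))].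

The second term is the response to a window of the input of length [2 a]; if
finite-time admissibility holds with a constant, it is bounded in [L^p] by the
norm of [u] on the two blocks of the window, uniformly in [k].  In the first
term [S] acts during a time at least [a], and analyticity makes [S a] bounded
from the extrapolation space to [X] ([smoothing_lift]).  So this term is
controlled by the norm of [Phi (m a) u] in the extrapolation space, where
exponential stability gives a geometric sum of the norms of [u] on the past
blocks ([state_bound]).  A discrete Young inequality ([Lnorm_block_young]) adds
up the blocks, for every [p] ([infinite_time_of_window]).

Admissibility is a statement about single inputs, so a constant has to be
produced first.  Instead of the closed graph theorem, inputs are glued along
disjoint time windows ([admissible_window_bound]).  If no window length had a
constant, one could place in [[0, t0]] windows that accumulate at [0], separated
by gaps, and on the window [k] an input [w k] of norm at most [2^-k] with a
response as large as desired.  The glued input lies in [L^p], hence its response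
[f] has a finite norm [F].  On the window [k], [f] differs from the response to
[w k] by the orbit of a vector that was smoothed during the gap, and whose size
is bounded before [w k] is chosen.  So the responses to the [w k] would be
bounded by [F] up to known constants, a contradiction.

The smoothing comes from differentiability at [a > 0] in operator norm: the
derivative is a bounded extension of [T a A], so that
[T a x = T a (lambda - A) (Rl x)] is bounded by the norm of [Rl x], which is
the norm of [x] in the extrapolation space ([analytic_smoothing]). *)

(** * Real-valued norms on complex normed spaces *)

Section NormZmod.
Context {R : realType} {V : normedZmodType R[i]}.
Implicit Types (v w : V).

Lemma rnormE v : `|v| = (rnorm v)%:C.
Proof.
rewrite /rnorm; have := normr_ge0 v; case: `|v| => a b /=.
by rewrite lecE /= => /andP[/eqP -> _].
Qed.

Lemma rnorm_ge0 v : 0 <= rnorm v.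
Proof. by have := normr_ge0 v; rewrite rnormE ler0c. Qed.

Lemma rnorm0 : rnorm (0 : V) = 0.
Proof. by rewrite /rnorm normr0. Qed.

Lemma rnormD v w : rnorm (v + w) <= rnorm v + rnorm w.
Proof. by have := ler_normD v w; rewrite !rnormE -rmorphD lecR. Qed.

Lemma rnormN v : rnorm (- v) = rnorm v.
Proof. by rewrite /rnorm normrN. Qed.

Lemma rnormB v w : rnorm (v - w) <= rnorm v + rnorm w.
Proof. by rewrite (le_trans (rnormD _ _))// rnormN. Qed.

Lemma rnorm_distC v w : rnorm (v - w) = rnorm (w - v).
Proof. by rewrite -rnormN opprB. Qed.

End NormZmod.

Lemma gt0_complex {R : realType} (e : R[i]) : 0 < e ->
  exists2 r : R, 0 < r & e = r%:C.
Proof.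
by case: e => r i; rewrite ltcE /= => /andP[/eqP -> r0]; exists r.
Qed.

Lemma rnorm_real {R : realType} (t : R) : rnorm (t%:C : R[i]) = `|t|.
Proof. by rewrite /rnorm normc_def /= expr0n addr0 sqrtr_sqr. Qed.

Section Norm.
Context {R : realType} {V : normedModType R[i]}.
Implicit Types (v w : V) (r : R).

Lemma rnormZc (c : R[i]) v : rnorm (c *: v) = rnorm c * rnorm v.
Proof. by apply: complexI; rewrite -rnormE normrZ !rnormE rmorphM. Qed.

Lemma rnormZ r v : rnorm (r%:C *: v) = `|r| * rnorm v.
Proof. by rewrite rnormZc rnorm_real. Qed.

Lemma rnorm_eq0 v : (rnorm v == 0) = (v == 0).
Proof. by rewrite -[v == 0]normr_eq0 rnormE eq_complex /= eqxx andbT. Qed.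

Lemma rnorm_lt v r : (`|v| < r%:C) = (rnorm v < r).
Proof. by rewrite rnormE ltcR. Qed.

Lemma rnorm_cvgP T (F : set_system T) {FF : Filter F} (f : T -> V) v :
  (f @ F --> v) <-> (fun x => rnorm (f x - v)) @ F --> (0 : R).
Proof.
split=> [/cvgr_dist_lt fv|/cvgrPdist_lt fv].
  apply/cvgrPdist_lt => e e0.
  have e0' : (0 : R[i]) < e%:C by rewrite ltcR.
  apply: filterS (fv _ e0') => x.
  by rewrite rnorm_lt sub0r normrN ger0_norm ?rnorm_ge0// rnorm_distC.
apply/cvgrPdist_lt => _ /gt0_complex[e e0 ->].
apply: filterS (fv _ e0) => x.
by rewrite rnorm_lt sub0r normrN ger0_norm ?rnorm_ge0// rnorm_distC.
Qed.

Lemma cvg_rnorm T (F : set_system T) {FF : Filter F} (f : T -> V) v :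
  f @ F --> v -> rnorm (f x) @[x --> F] --> rnorm v.
Proof.
move=> /rnorm_cvgP /cvgrPdist_lt fv; apply/cvgrPdist_lt => e e0.
apply: filterS (fv _ e0) => x; rewrite sub0r normrN ger0_norm ?rnorm_ge0//.
apply: le_lt_trans.
have h1 := rnormD (f x - v) v; have h2 := rnormD (v - f x) (f x).
move: h1 h2; rewrite !subrK (rnorm_distC v) ler_norml => h1 h2.
by apply/andP; split; lra.
Qed.

End Norm.

Lemma eq_cvgn (T : topologicalType) (u w : nat -> T) (l : T) :
  (forall n, u n = w n) -> u n @[n --> \oo] --> l -> w n @[n --> \oo] --> l.
Proof. by move=> /funext ->. Qed.

Lemma rnorm_cauchy_cvg {R : realType} {X : completeNormedModType R[i]}
    (u : nat -> X) :
  (forall e : R, 0 < e ->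
    exists N, forall n, (N <= n)%N -> rnorm (u N - u n) < e) ->
  exists l : X, u n @[n --> \oo] --> l.
Proof.
move=> uc; suff : cvg ((u : nat -> X) @ \oo) by move=> /cvg_ex.
apply: cauchy_cvg; apply: cauchy_exP => _ /gt0_complex[e e0 ->].
have [N uN] := uc _ e0; exists (u N); exists N => // n /= /uN.
by rewrite -ball_normE /ball_ /= rnorm_lt.
Qed.

Section LinearBound.
Context {R : realType} {V W : normedModType R[i]}.

Lemma continuous_linear_rnorm (f : {linear V -> W}) : continuous f ->
  exists2 C : R, 0 < C & forall v, rnorm (f v) <= C * rnorm v.
Proof.
move=> cf.
have /rnorm_cvgP/cvgrPdist_lt/(_ _ ltr01) := cf 0; rewrite linear0.
rewrite near_nbhs => /nbhs_normP[_ /= /gt0_complex[r r0 ->] fe].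
exists (2 / r); first by rewrite divr_gt0.
move=> v; have [->|v0] := eqVneq v 0; first by rewrite linear0 !rnorm0 mulr0.
have nv0 : 0 < rnorm v by rewrite lt_def rnorm_eq0 v0 rnorm_ge0.
pose k := r / 2 / rnorm v.
have k0 : 0 < k by rewrite !divr_gt0.
have : ball_ Num.norm 0 r%:C (k%:C *: v).
  rewrite /ball_/= sub0r normrN rnorm_lt rnormZ gtr0_norm// /k divfK ?gt_eqF//.
  by rewrite ltr_pdivrMr// mulr_natr mulr2n ltrDr.
move=> /fe; rewrite /= linearZ subr0 rnormZ sub0r normrN normrM normr_id.
rewrite (gtr0_norm k0) (ger0_norm (rnorm_ge0 _)) => /ltW.
rewrite -ler_pdivlMl// mulr1 => /le_trans; apply.
by rewrite /k !invfM !invrK [r^-1 * 2]mulrC.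
Qed.

Lemma bounded_linear_rnorm (f : {linear V -> W}) (C : R) :
  (forall v, rnorm (f v) <= C * rnorm v) -> continuous f.
Proof.
move=> fC v; apply/rnorm_cvgP.
have vv : rnorm (w - v) @[w --> v] --> (0 : R).
  by apply/rnorm_cvgP; exact: cvg_id.
have Cv : C * rnorm (w - v) @[w --> v] --> (0 : R).
  by rewrite -(mulr0 C); apply: cvgMr.
apply: squeeze_cvgr (cvg_cst 0) Cv; apply: nearW => w.
by rewrite rnorm_ge0 -linearB fC.
Qed.

Lemma dense_rnorm (j : V -> W) (y : W) (e : R) : dense (range j) -> 0 < e ->
  exists x, rnorm (y - j x) < e.
Proof.
move=> dj e0; have e0' : (0 : R[i]) < e%:C by rewrite ltcR.
have [] := dj (ball y e%:C).
- by exists y; exact: ballxx.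
- exact: ball_open.
move=> z [+ [x _ xz]]; rewrite -xz => yx; exists x; move: yx.
by rewrite -ball_normE /ball_ /= rnorm_lt.
Qed.

End LinearBound.

(** * Finitely valued Borel functions *)

Local Notation mu := lebesgue_measure.

Lemma le_mu {R : realType} (A B : set R) : measurable A -> measurable B ->
  A `<=` B -> (mu A <= mu B)%E.
Proof.
move=> mA mB AB; apply: le_measure => //; rewrite inE; [exact: mA|exact: mB].
Qed.

Section FinitelyValued.
Context {R : realType}.

(** The notion of simple function for values in any type: approximants are
built from pairs of a time and a vector, or of a truth value and two vectors. *)
Definition finitely_valued (W : Type) (w : R -> W) : Prop :=
  finite_set (range w) /\ forall a, measurable (w @^-1` [set a]).

Lemma finitely_valued_preimage (W : Type) (w : R -> W) (A : set W) :
  finitely_valued w -> measurable (w @^-1` A).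
Proof.
move=> [fw mw].
have -> : w @^-1` A = \bigcup_(a in range w `&` A) w @^-1` [set a].
  apply/seteqP; split => [x Ax|x [a [_ Aa] /= ->]//].
  by exists (w x); rewrite //=; split => //; exists x.
apply: fin_bigcup_measurable => //.
by apply: sub_finite_set fw; exact: subIsetl.
Qed.

Lemma finitely_valued_comp (W W' : Type) (w : R -> W) (h : W -> W') :
  finitely_valued w -> finitely_valued (h \o w).
Proof.
move=> fw; split=> [|a].
  have -> : range (h \o w) = h @` range w.
    by apply/seteqP; split => [_ [x _ <-]|_ [_ [x _ <-] <-]];
      [exists (w x) => //; exists x|exists x].
  by apply: finite_image; case: fw.
by rewrite -/(preimage _ _) comp_preimage; exact: finitely_valued_preimage.
Qed.

Lemma finitely_valued_cst (W : Type) (a : W) :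
  finitely_valued (fun _ : R => a).
Proof.
split=> [|b]; first by apply: sub_finite_set (finite_set1 a) => _ [x _ <-].
have [->|ab] := pselect (a = b).
  by have -> : (fun _ : R => b) @^-1` [set b] = setT by apply/seteqP; split.
have -> : (fun _ : R => a) @^-1` [set b] = set0 by apply/seteqP; split.
exact: measurable0.
Qed.

Lemma finitely_valued_pair (W W' : Type) (w : R -> W) (w' : R -> W') :
  finitely_valued w -> finitely_valued w' ->
  finitely_valued (fun x => (w x, w' x)).
Proof.
move=> [fw mw] [fw' mw']; split=> [|[a b]].
  apply: sub_finite_set (finite_setX fw fw').
  by move=> _ [x _ <-] /=; split; exists x.
have -> : (fun x => (w x, w' x)) @^-1` [set (a, b)] =
    w @^-1` [set a] `&` w' @^-1` [set b].
  by apply/seteqP; split => x /= [-> ->].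
exact: measurableI.
Qed.

Lemma finitely_valued_bool (D : set R) : measurable D ->
  finitely_valued (fun x => `[< D x >]).
Proof.
move=> mD; split=> [|[]].
- exact: finite_finset.
- by have -> : (fun x => `[< D x >]) @^-1` [set true] = D
    by apply/seteqP; split=> x /=; [move/asboolP|move=> ?; exact/asboolP].
- have -> : (fun x => `[< D x >]) @^-1` [set false] = ~` D.
    by apply/seteqP; split=> x /=; [move/asboolPn|move=> ?; exact/asboolPn].
  exact: measurableC.
Qed.

Lemma finitely_valued_if (W : Type) (D : set R) (w w' : R -> W) :
  measurable D -> finitely_valued w -> finitely_valued w' ->
  finitely_valued (fun x => if `[< D x >] then w x else w' x).
Proof.
move=> mD fw fw'.
exact: (finitely_valued_comp (fun c : bool * (W * W) =>
  if c.1 then c.2.1 else c.2.2) (finitely_valued_pair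
    (finitely_valued_bool mD) (finitely_valued_pair fw fw'))).
Qed.

Lemma finitely_valued_shift (W : Type) (w : R -> W) (b : R) :
  finitely_valued w -> finitely_valued (fun x => w (x + b)).
Proof.
move=> [fw mw]; split=> [|a].
  by apply: sub_finite_set fw => _ [x _ <-]; exists (x + b).
rewrite -[_ @^-1` _]setTI.
have : measurable_fun setT (fun x : R => x + b) by exact: measurable_funD.
by move=> /(_ measurableT _ (mw a)).
Qed.

Lemma finitely_valued_measurable (w : R -> R) :
  finitely_valued w -> measurable_fun setT w.
Proof.
by move=> fw _ A mA; rewrite setTI; exact: finitely_valued_preimage.
Qed.

Lemma finitely_valued_seq (W : eqType) (w : R -> W) : finitely_valued w ->
  exists2 r : seq W, uniq r & forall x, w x \in r.
Proof.
move=> [/finite_seqP[r wr] _]; exists (undup r); first exact: undup_uniq.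
move=> x; rewrite mem_undup.
have : range w (w x) by exists x.
by rewrite wr.
Qed.

(** Regrouping the level sets of [w] according to the value of [h]; it lets
the integral of [h \o w] be computed on the finer level sets of [w]. *)
Lemma measure_preimage_comp (W W' : choiceType) (w : R -> W) (h : W -> W')
    (r : seq W) (D : set R) (b : W') :
  finitely_valued w -> uniq r -> (forall x, w x \in r) ->
  measurable D -> (mu D < +oo)%E ->
  fine (mu (D `&` (h \o w) @^-1` [set b])) =
  \sum_(a <- r | h a == b) fine (mu (D `&` w @^-1` [set a])).
Proof.
move=> fw ur wr mD Doo.
have mw a : measurable (D `&` w @^-1` [set a]).
  by apply: measurableI => //; case: fw.
rewrite sum_fine; last first.
  move=> a _; rewrite ge0_fin_numE ?measure_ge0//.
  exact: le_lt_trans (le_mu (mw a) mD (@subIsetl _ _ _)) Doo.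
congr fine.
rewrite -big_filter fsbig_seq ?filter_uniq// -measure_fin_bigcup//.
  congr (mu _); apply/seteqP; split=> x /=.
    by move=> [Dx hx]; exists (w x) => //=; rewrite mem_filter wr hx eqxx.
  by move=> [a /= + [Dx wa]]; rewrite mem_filter => /andP[/eqP <- _];
    split=> //=; rewrite wa.
  by move=> a a' _ _ [x /= [[_ <-] [_ <-]]].
by move=> a _; exact: mw.
Qed.

End FinitelyValued.

(** * The integral of simple functions *)

Section SimpleIntegralComp.
Context {R : realType} {X : completeNormedModType R[i]}.
Implicit Types D : set R.

(** Evaluated on the level sets of any [w] through which it factors, the
integral is visibly linear: two simple functions are compared on the level sets
of the pair that they form. *)
Lemma simple_integral_comp (W : choiceType) (w : R -> W) (h : W -> X)
    (r : seq W) D :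
  finitely_valued w -> uniq r -> (forall x, w x \in r) ->
  measurable D -> (mu D < +oo)%E ->
  simple_integral D (h \o w) =
  \sum_(a <- r) (fine (mu (D `&` w @^-1` [set a])))%:C *: h a.
Proof.
move=> fw ur wr mD Doo; rewrite /simple_integral.
rewrite (@fsbig_fwiden _ _ _ _ (undup (map h r))) ?undup_uniq//; last 2 first.
- by move=> _ [x _ <-] /=; rewrite mem_undup; apply/map_f/wr.
- move=> v /= [_ hv]; rewrite (_ : _ @^-1` _ = set0); last first.
    by apply/seteqP; split => x //= hx; apply: hv; exists x.
  by rewrite setI0 measure0 /= scale0r.
under eq_bigr do rewrite (measure_preimage_comp _ _ fw ur wr mD Doo)
  rmorph_sum scaler_suml.
rewrite (exchange_big_dep predT)//= big_seq [RHS]big_seq.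
apply: eq_bigr => a ar; rewrite big_mkcond (bigD1_seq (h a)) ?undup_uniq//=.
  rewrite eqxx big1 ?addr0// => v /negbTE; rewrite eq_sym => ->.
  by [].
by rewrite mem_undup map_f.
Qed.

Lemma integral_finitely_valued (W : choiceType) (w : R -> W) (h : W -> R)
    (r : seq W) D :
  finitely_valued w -> uniq r -> (forall x, w x \in r) ->
  (forall a, 0 <= h a) -> measurable D -> (mu D < +oo)%E ->
  (\int[mu]_(x in D) (h (w x))%:E =
  (\sum_(a <- r) fine (mu (D `&` w @^-1` [set a])) * h a)%:E)%E.
Proof.
move=> fw ur wr h0 mD Doo.
have mw a : measurable (D `&` w @^-1` [set a]).
  by apply: measurableI => //; case: fw.
have mw' a : measurable (w @^-1` [set a]) by case: fw.
transitivity (\int[mu]_(x in D) (\sum_(a <- r)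
    (h a)%:E * (\1_(w @^-1` [set a]) x)%:E))%E.
  apply: eq_integral => x _; rewrite (bigD1_seq (w x))//= big1 ?adde0.
    by rewrite indicE mem_set// mule1.
  by move=> a /eqP aw; rewrite indicE memNset ?mule0// => /= wa; exact: aw.
rewrite ge0_integral_sum//; first last.
- by move=> a x _; rewrite mule_ge0 ?lee_fin.
- move=> a; apply/measurable_EFinP; apply: measurable_funM => //.
  by apply: measurable_indic; exact: (mw' a).
rewrite -sumEFin; apply: eq_bigr => a _.
rewrite ge0_integralZl_EFin//; last first.
  by apply/measurable_EFinP; apply: measurable_indic; exact: (mw' a).
rewrite integral_indic; [|exact: mD|exact: (mw' a)].
rewrite setIC EFinM muleC; congr (_ * _)%E.
rewrite fineK// ge0_fin_numE ?measure_ge0//.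
exact: le_lt_trans (le_mu (mw a) mD (@subIsetl _ _ _)) Doo.
Qed.

End SimpleIntegralComp.

Section SimpleIntegral.
Context {R : realType} {X Y : completeNormedModType R[i]}.
Implicit Types (D : set R) (s : R -> X).

Section Props.
Context (D : set R) (mD : measurable D) (Doo : (mu D < +oo)%E).

Lemma simple_integralB s s' : simple_function s -> simple_function s' ->
  simple_integral D (fun x => s x - s' x) =
  simple_integral D s - simple_integral D s'.
Proof.
move=> fs fs'; have fw := finitely_valued_pair fs fs'.
have [r ur wr] := finitely_valued_seq fw.
have E (h : X * X -> X) := simple_integral_comp h fw ur wr mD Doo.
have /= -> := E (fun c => c.1 - c.2).
have /= -> := E fst; have /= -> := E snd.
by rewrite -sumrB; apply: eq_bigr => a _; rewrite scalerBr.
Qed.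

Lemma le_simple_integral s : simple_function s ->
  ((rnorm (simple_integral D s))%:E <= \int[mu]_(x in D) (rnorm (s x))%:E)%E.
Proof.
move=> fs; have [r ur wr] := finitely_valued_seq fs.
rewrite (integral_finitely_valued fs ur wr (fun v =>
  rnorm_ge0 v) mD Doo) lee_fin.
have /= -> := simple_integral_comp id fs ur wr mD Doo.
elim/big_rec2 : _ => [|a x y _ yx]; first by rewrite rnorm0.
apply: le_trans (rnormD _ _) _; rewrite lerD// rnormZ ger0_norm//.
by rewrite fine_ge0.
Qed.

Lemma simple_integral_linear (L : {linear X -> Y}) s : simple_function s ->
  simple_integral D (L \o s) = L (simple_integral D s).
Proof.
move=> fs; have [r ur wr] := finitely_valued_seq fs.
have /= -> := simple_integral_comp id fs ur wr mD Doo.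
rewrite (simple_integral_comp L fs ur wr mD Doo) linear_sum.
by apply: eq_bigr => a _; rewrite linearZ.
Qed.

Lemma eq_simple_integral s s' : simple_function s -> simple_function s' ->
  (forall x, D x -> s x = s' x) -> simple_integral D s = simple_integral D s'.
Proof.
move=> fs fs' ss'; apply/eqP; rewrite -subr_eq0 -simple_integralB//.
rewrite -rnorm_eq0 eq_le rnorm_ge0 andbT -lee_fin.
have fw : simple_function (fun x => s x - s' x).
  exact: (finitely_valued_comp (fun c =>
    c.1 - c.2) (finitely_valued_pair fs fs')).
apply: le_trans (le_simple_integral fw) _.
by rewrite integral0_eq// => x Dx; rewrite ss'// subrr rnorm0.
Qed.

End Props.

Lemma simple_integralU D D' s : measurable D -> measurable D' ->
  (mu D < +oo)%E -> (mu D' < +oo)%E -> D `&` D' = set0 -> simple_function s ->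
  simple_integral (D `|` D') s = simple_integral D s + simple_integral D' s.
Proof.
move=> mD mD' Doo Doo' DD' fs; have [r ur wr] := finitely_valued_seq fs.
have mU := measurableU _ _ mD mD'.
have Uoo : (mu (D `|` D') < +oo)%E.
  by rewrite measureU// lte_add_pinfty.
have /= -> := simple_integral_comp id fs ur wr mD Doo.
have /= -> := simple_integral_comp id fs ur wr mD' Doo'.
have /= -> := simple_integral_comp id fs ur wr mU Uoo.
rewrite -big_split; apply: eq_bigr => a _ /=; rewrite -scalerDl -rmorphD.
have ma : measurable (s @^-1` [set a]) by case: fs.
have m1 := measurableI _ _ mD ma; have m2 := measurableI _ _ mD' ma.
have fin E : measurable E -> (mu E < +oo)%E ->
    mu (E `&` s @^-1` [set a]) \is a fin_num.
  move=> mE Eoo; rewrite ge0_fin_numE ?measure_ge0//.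
  exact: le_lt_trans (le_mu (measurableI _ _ mE ma) mE (@subIsetl _ _ _)) Eoo.
rewrite setIUl measureU ?fineD ?fin//.
by rewrite setIACA DD' set0I.
Qed.

End SimpleIntegral.

(** * Translation invariance of the Lebesgue measure *)

Section Shift.
Context {R : realType}.

Lemma measurable_shift (b : R) :
  measurable_fun [set: measurableTypeR R]
    ((fun x => x + b) : measurableTypeR R -> measurableTypeR R).
Proof. exact: measurable_funD. Qed.

Lemma measurable_preimage_shift (b : R) (A : set R) : measurable A ->
  measurable [set x | A (x + b)].
Proof.
move=> mA; have := @measurable_shift b measurableT A mA.
by rewrite setTI.
Qed.

(** Both sides are measures in [A] that agree on half-open intervals. *)
Lemma lebesgue_measure_shift (b : R) (A : set R) : measurable A ->
  mu [set x | A (x + b)] = mu A.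
Proof.
move=> mA.
apply/esym; rewrite -[RHS]/(pushforward mu
  ((fun x => x + b) : measurableTypeR R -> measurableTypeR R) A).
apply: lebesgue_measure_unique => //; first exact: (measurable_shift b).
move=> ms _ [[x y] _ <-] /=.
rewrite /pushforward (_ : _ @^-1` _ = `](x - b), (y - b)]%classic).
  rewrite !lebesgue_measure_itv /= !lte_fin ltrD2r.
  by case: ifP => // _; rewrite -!EFinB opprB addrA subrK.
by apply/seteqP; split => z /=; rewrite !in_itv /= ltrBlDr lerBrDr.
Qed.

Lemma ge0_integral_shift (b : R) (D : set R) (f : R -> R) :
  measurable D -> measurable_fun D f -> (forall x, D x -> 0 <= f x) ->
  (\int[mu]_(x in [set x | D (x + b)%R]) (f (x + b))%:E =
   \int[mu]_(x in D) (f x)%:E)%E.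
Proof.
move=> mD mf f0.
transitivity (\int[pushforward mu
    ((fun x => (x + b)%R) : measurableTypeR R -> measurableTypeR R)]_(x in D)
    (f x)%:E)%E.
  rewrite (ge0_integral_pushforward (measurable_shift b)) //.
  - exact/measurable_EFinP.
  - by move=> x; rewrite inE => /f0; rewrite lee_fin.
apply: (eq_measure_integral mu) => [|ms A mA _];
  last exact: (lebesgue_measure_shift b mA).
exact: (measurable_shift b).
Qed.

End Shift.

(** * Strong measurability *)

Section StronglyMeasurable.
Context {R : realType} {X : completeNormedModType R[i]}.
Implicit Types (D : set R) (f g : R -> X).

Lemma strongly_measurable_simple D (s : R -> X) : simple_function s ->
  strongly_measurable D s.
Proof. by move=> fs; exists (fun _ => s) => // x _; exact: cvg_cst. Qed.

Lemma strongly_measurable_cst D (a : X) : strongly_measurable D (fun _ => a).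
Proof.
exact/strongly_measurable_simple/finitely_valued_cst.
Qed.

Lemma sub_strongly_measurable D D' f : D' `<=` D ->
  strongly_measurable D f -> strongly_measurable D' f.
Proof. by move=> DD [s fs sf]; exists s => // x /DD; exact: sf. Qed.

Lemma eq_strongly_measurable D f g : (forall x, D x -> f x = g x) ->
  strongly_measurable D f -> strongly_measurable D g.
Proof.
by move=> fg [s fs sf]; exists s => // x Dx; rewrite -fg//; exact: sf.
Qed.

Lemma strongly_measurable_shift D f (b : R) : strongly_measurable D f ->
  strongly_measurable [set x | D (x + b)] (fun x => f (x + b)).
Proof.
move=> [s fs sf]; exists (fun n x => s n (x + b)) => [n|x /sf//].
exact: (finitely_valued_shift b (fs n)).
Qed.

Lemma measurable_rnorm D f : strongly_measurable D f ->
  measurable_fun D (fun x => rnorm (f x)).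
Proof.
move=> [s fs sf]; apply: (@measurable_fun_cvg _ _ _ D (fun n x =>
  rnorm (s n x))).
  move=> n; apply: measurable_funTS; apply: finitely_valued_measurable.
  exact: (finitely_valued_comp (fun v : X => rnorm v) (fs n)).
by move=> x Dx; apply: cvg_rnorm; exact: sf.
Qed.

Lemma strongly_measurable_if (D E : set R) f g : measurable E ->
  strongly_measurable (D `&` E) f -> strongly_measurable (D `\` E) g ->
  strongly_measurable D (fun x => if `[< E x >] then f x else g x).
Proof.
move=> mE [s fs sf] [t ft tg].
exists (fun n x => if `[< E x >] then s n x else t n x).
  by move=> n; exact: (finitely_valued_if mE (fs n) (ft n)).
by move=> x Dx; case: asboolP => Ex; [exact: sf|exact: tg].
Qed.

(** The simple approximants of the pieces are glued on finitely many pieces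
only, so that they keep a finite range. *)
Lemma strongly_measurable_glue (K : R -> nat) D f :
  (forall k, measurable [set x | K x = k]) ->
  (forall k, strongly_measurable (D `&` [set x | K x = k]) f) ->
  strongly_measurable D f.
Proof.
move=> mK smf.
have /choice[s sP] : forall k, exists t : nat -> R -> X,
    (forall n, simple_function (t n)) /\
    forall x, (D `&` [set x | K x = k]) x -> t n x @[n --> \oo] --> f x.
  by move=> k; have [t ft tf] := smf k; exists t.
exists (fun n x => if (K x < n)%N then s (K x) n x else 0).
  move=> n; suff : forall N, finitely_valued
      (fun x => if (K x < N)%N then s (K x) n x else 0) by exact.
  elim=> [|N IH].
    exact: (@finitely_valued_cst R X 0).
  have -> : (fun x => if (K x < N.+1)%N then s (K x) n x else 0) =
      (fun x => if `[< K x = N >] then s N n x else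
        if (K x < N)%N then s (K x) n x else 0).
    apply/funext => x; case: asboolP => [->|/eqP KN]; first by rewrite ltnSn.
    by rewrite ltnS leq_eqVlt (negbTE KN).
  exact: (finitely_valued_if (mK N) ((sP N).1 n) IH).
move=> x Dx; have := (sP (K x)).2 x (conj Dx erefl).
apply: cvg_trans; apply: near_eq_cvg.
by exists (K x).+1 => // n /= ->.
Qed.

End StronglyMeasurable.

Section StronglyMeasurableComp.
Context {R : realType} {X Y Z : completeNormedModType R[i]}.
Implicit Types D : set R.

(** The joint level sets of two approximants are again finite in number, and
sequential continuity of [h] is all that the limit needs. *)
Lemma strongly_measurable_comp2 D (h : X -> Y -> Z) (f : R -> X) (g : R -> Y) :
  (forall (s : nat -> X) (t : nat -> Y) x y, s n @[n --> \oo] --> x ->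
    t n @[n --> \oo] --> y -> h (s n) (t n) @[n --> \oo] --> h x y) ->
  strongly_measurable D f -> strongly_measurable D g ->
  strongly_measurable D (fun x => h (f x) (g x)).
Proof.
move=> hc [s fs sf] [t ft tg]; exists (fun n x => h (s n x) (t n x)).
  move=> n; exact: (finitely_valued_comp (fun c => h c.1 c.2)
    (finitely_valued_pair (fs n) (ft n))).
by move=> x Dx; apply: hc; [exact: sf|exact: tg].
Qed.

Lemma strongly_measurable_comp D (h : X -> Y) (f : R -> X) : continuous h ->
  strongly_measurable D f -> strongly_measurable D (h \o f).
Proof.
move=> hc [s fs sf]; exists (fun n => h \o s n).
  by move=> n; exact: (finitely_valued_comp h (fs n)).
by move=> x /sf; apply: continuous_cvg; exact: hc.
Qed.

End StronglyMeasurableComp.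

Section StronglyMeasurableAdd.
Context {R : realType} {X : completeNormedModType R[i]}.
Implicit Types (D : set R) (f g : R -> X).

Lemma strongly_measurableD D f g : strongly_measurable D f ->
  strongly_measurable D g -> strongly_measurable D (fun x => f x + g x).
Proof. by apply: strongly_measurable_comp2 => *; exact: cvgD. Qed.

Lemma strongly_measurableB D f g : strongly_measurable D f ->
  strongly_measurable D g -> strongly_measurable D (fun x => f x - g x).
Proof. by apply: (strongly_measurable_comp2 (h := fun a b => a - b)) => *;
  exact: cvgB. Qed.

End StronglyMeasurableAdd.

(** * The Bochner integral *)

Section RealIntegral.
Context {R : realType}.
Implicit Types (D : set R) (f g : R -> R).

Lemma le_integral_real D f g : measurable D ->
  measurable_fun D f -> measurable_fun D g -> (forall x, D x -> 0 <= f x) ->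
  (forall x, D x -> f x <= g x) ->
  (\int[mu]_(x in D) (f x)%:E <= \int[mu]_(x in D) (g x)%:E)%E.
Proof.
move=> mD mf mg f0 fg; apply: ge0_le_integral => //.
- exact/measurable_EFinP.
- exact/measurable_EFinP.
Qed.

Lemma integralD_real D f g : measurable D ->
  measurable_fun D f -> measurable_fun D g -> (forall x, D x -> 0 <= f x) ->
  (forall x, D x -> 0 <= g x) ->
  (\int[mu]_(x in D) (f x + g x)%:E =
   \int[mu]_(x in D) (f x)%:E + \int[mu]_(x in D) (g x)%:E)%E.
Proof.
move=> mD mf mg f0 g0; under eq_integral do rewrite EFinD.
rewrite ge0_integralD//; exact/measurable_EFinP.
Qed.

Lemma integralZ_real D f (c : R) : measurable D -> measurable_fun D f ->
  (forall x, D x -> 0 <= f x) -> 0 <= c ->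
  (\int[mu]_(x in D) (c * f x)%:E = c%:E * \int[mu]_(x in D) (f x)%:E)%E.
Proof.
move=> mD mf f0 c0; under eq_integral do rewrite EFinM.
rewrite ge0_integralZl_EFin//; exact/measurable_EFinP.
Qed.

Lemma sub_integral_real D D' f : measurable D -> measurable D' ->
  measurable_fun D' f -> (forall x, D' x -> 0 <= f x) -> D `<=` D' ->
  (\int[mu]_(x in D) (f x)%:E <= \int[mu]_(x in D') (f x)%:E)%E.
Proof.
move=> mD mD' mf f0 DD'; apply: ge0_subset_integral => //.
exact/measurable_EFinP.
Qed.

End RealIntegral.

Section Bochner.
Context {R : realType} {X : completeNormedModType R[i]}.
Implicit Types (D : set R) (f g : R -> X).

(** The integrals of two approximants of [f] are as close as the approximants
are to [f] in [L^1]: this gives both uniqueness of the Bochner integral and the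
Cauchy property behind its existence. *)
Lemma simple_integral_dist D f s t : measurable D -> (mu D < +oo)%E ->
  strongly_measurable D f -> simple_function s -> simple_function t ->
  ((rnorm (simple_integral D s - simple_integral D t))%:E <=
    \int[mu]_(x in D) (rnorm (f x - s x))%:E +
    \int[mu]_(x in D) (rnorm (f x - t x))%:E)%E.
Proof.
move=> mD Doo smf fs ft; rewrite -simple_integralB//.
have sm (u : R -> X) : simple_function u -> strongly_measurable D u.
  exact: strongly_measurable_simple.
have fw : simple_function (fun x => s x - t x).
  exact: (finitely_valued_comp (fun c =>
    c.1 - c.2) (finitely_valued_pair fs ft)).
apply: le_trans (le_simple_integral mD Doo fw) _.
have ms := measurable_rnorm (strongly_measurableB smf (sm _ fs)).
have mt := measurable_rnorm (strongly_measurableB smf (sm _ ft)).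
rewrite -integralD_real//; try by move=> *; exact: rnorm_ge0.
apply: le_integral_real => //.
- exact: measurable_rnorm (sm _ fw).
- exact: measurable_funD.
- by move=> *; exact: rnorm_ge0.
move=> x _; rewrite (rnorm_distC (f x) (s x)).
by rewrite -[in leLHS](subrK (f x) (s x)) -addrA rnormD.
Qed.

Lemma bochner_integral_unique D f v w : measurable D -> (mu D < +oo)%E ->
  is_bochner_integral D f v -> is_bochner_integral D f w -> v = w.
Proof.
move=> mD Doo [smf [s [fs fss sv]]] [_ [t [ft ftt tw]]].
apply/eqP; rewrite -subr_eq0 -rnorm_eq0 eq_le rnorm_ge0 andbT -lee_fin.
have h' : (\int[mu]_(x in D) (rnorm (f x - s n x))%:E +
    \int[mu]_(x in D) (rnorm (f x - t n x))%:E)%E @[n --> \oo] --> (0 : \bar R).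
  by rewrite -(adde0 0%E); exact: cvgeD.
have h1 : (rnorm (simple_integral D (s n) - simple_integral D (t n)))%:E
    @[n --> \oo] --> (rnorm (v - w))%:E.
  by apply: cvg_EFin; [exact: nearW|apply: cvg_rnorm; exact: cvgB].
apply: (lee_cvg_to h1 h').
by apply: nearW => n; exact: simple_integral_dist.
Qed.

Lemma bochner_integral_eq D f v : measurable D -> (mu D < +oo)%E ->
  is_bochner_integral D f v -> bochner_integral D f = v.
Proof.
move=> mD Doo fv; rewrite /bochner_integral.
case: xgetP => [w _ fw|/(_ v)//].
exact: bochner_integral_unique fw fv.
Qed.

Lemma le_bochner_integral D f v : measurable D -> (mu D < +oo)%E ->
  is_bochner_integral D f v ->
  ((rnorm v)%:E <= \int[mu]_(x in D) (rnorm (f x))%:E)%E.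
Proof.
move=> mD Doo [smf [s [fs fss sv]]].
have h1 : (rnorm (simple_integral D (s n)))%:E @[n --> \oo] --> (rnorm v)%:E.
  by apply: cvg_EFin; [exact: nearW|exact: cvg_rnorm sv].
pose I := (\int[mu]_(x in D) (rnorm (f x))%:E)%E.
have I0 : (I +? 0)%E.
  apply: ge0_adde_def; rewrite inE//.
  by apply: integral_ge0 => x _; rewrite lee_fin rnorm_ge0.
have h2 : (I + \int[mu]_(x in D) (rnorm (f x - s n x))%:E)%E
    @[n --> \oo] --> I.
  by rewrite -[X in _ --> X]adde0; apply: cvgeD => //; exact: cvg_cst.
apply: (lee_cvg_to h1 h2).
apply: nearW => n; have f0 : simple_function (fun _ : R => 0 : X).
  exact: finitely_valued_cst.
have := simple_integral_dist mD Doo smf f0 (fs n).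
have -> : simple_integral D (fun _ => 0 : X) = 0.
  have := le_simple_integral mD Doo f0; rewrite integral0_eq; last first.
    by move=> x _; rewrite rnorm0.
  by rewrite lee_fin => h0; apply/eqP; rewrite -rnorm_eq0 eq_le h0 rnorm_ge0.
rewrite sub0r rnormN; under eq_integral do rewrite subr0.
by [].
Qed.

(** The approximants given by strong measurability converge pointwise only.
Replacing them by [0] wherever their norm exceeds [2 * rnorm (f x)] keeps the
convergence and makes them dominated. *)
Lemma bochner_integral_exists D f : measurable D -> (mu D < +oo)%E ->
  strongly_measurable D f ->
  (\int[mu]_(x in D) (rnorm (f x))%:E < +oo)%E ->
  exists v, is_bochner_integral D f v.
Proof.
move=> mD Doo smf foo; have [s fs sf] := smf.
have mf := measurable_rnorm smf.
have ms n : measurable_fun D (fun x => rnorm (s n x)).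
  exact: measurable_rnorm (strongly_measurable_simple D (fs n)).
pose E n := D `&` (fun x => 2 * rnorm (f x) - rnorm (s n x)) @^-1` `[0, +oo[.
have mE n : measurable (E n).
  apply: (_ : measurable_fun D _) => //.
  by apply: measurable_funB => //; exact: measurable_funM.
pose t n x := if `[< E n x >] then s n x else 0.
have ft n : simple_function (t n).
  by apply: finitely_valued_if (mE n) (fs n) _; exact: finitely_valued_cst.
have tf x : D x -> t n x @[n --> \oo] --> f x.
  move=> Dx; have [fx0|fx0] := eqVneq (f x) 0.
    have -> : (fun n => t n x) = fun _ => f x.
      apply/funext => n; rewrite /t; case: asboolP => //= -[_].
      rewrite /= in_itv /= fx0 rnorm0 mulr0 sub0r andbT oppr_ge0 => sn.
      by apply/eqP; rewrite -rnorm_eq0 eq_le sn rnorm_ge0.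
    exact: cvg_cst.
  apply: cvg_trans (sf _ Dx); apply: near_eq_cvg.
  have fxp : 0 < rnorm (f x) by rewrite lt_def rnorm_eq0 fx0 rnorm_ge0.
  have /cvgrPdist_lt/(_ _ fxp) : rnorm (s n x) @[n --> \oo] --> rnorm (f x).
    by apply: cvg_rnorm; exact: sf.
  apply: filterS => n.
  rewrite /t; case: asboolP => // nE h; exfalso; apply: nE; split => //=.
  rewrite in_itv /= andbT.
  by move: h; rewrite ltr_norml => /andP[h _]; lra.
have smt n := strongly_measurable_simple D (ft n).
have mft n := measurable_rnorm (strongly_measurableB smf (smt n)).
have L1 : (\int[mu]_(x in D) (rnorm (f x - t n x))%:E)%E @[n --> \oo] --> 0%E.
  have [] := @dominated_convergence _ _ _ mu D mD
    (fun n x => (rnorm (f x - t n x))%:E) (cst 0%E)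
    (fun x => (3 * rnorm (f x))%:E).
  - by move=> n; apply/measurable_EFinP; exact: (mft n).
  - exact: measurable_cst.
  - apply: aeW => x Dx; apply: cvg_EFin; first exact: nearW.
    have /rnorm_cvgP := tf x Dx.
    by under eq_fun do rewrite rnorm_distC.
  - apply/integrableP; split.
      by apply/measurable_EFinP; exact: measurable_funM.
    under eq_integral do rewrite /= ger0_norm ?mulr_ge0 ?rnorm_ge0//.
    rewrite integralZ_real//; last by move=> *; exact: rnorm_ge0.
    by rewrite lte_mul_pinfty.
  - apply: aeW => x n Dx; rewrite lee_fin ger0_norm ?rnorm_ge0//.
    rewrite (le_trans (rnormB _ _))// /t.
    case: asboolP => [[_]|_]; last by rewrite rnorm0; have := rnorm_ge0 (f x);
      lra.
    by rewrite /= in_itv /= andbT; lra.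
  by move=> _ _; rewrite integral0.
have [v tv] : exists v : X, simple_integral D (t n) @[n --> \oo] --> v.
  apply: rnorm_cauchy_cvg => e e0.
  have /fine_cvgP[Lfin /cvgrPdist_lt/(_ (e / 2))] := L1.
  rewrite divr_gt0// => /(_ isT) Le.
  have [N _ NP] := filterI Lfin Le.
  exists N => n Nn.
  have [/= fN eN] := NP N (leqnn N); have [/= fn en] := NP n Nn.
  have := simple_integral_dist mD Doo smf (ft N) (ft n).
  move: eN en; rewrite -(fineK fN) -(fineK fn) -EFinD lee_fin /=.
  rewrite !sub0r !normrN => eN en h.
  have := ler_norm (fine (\int[mu]_(x in D) (rnorm (f x - t N x))%:E)%E).
  have := ler_norm (fine (\int[mu]_(x in D) (rnorm (f x - t n x))%:E)%E).
  by lra.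
by exists v; split=> //; exists t; split.
Qed.

End Bochner.

(** * Domains, translations and linear maps under the Bochner integral *)

Section BochnerDomain.
Context {R : realType} {X : completeNormedModType R[i]}.
Implicit Types (D : set R) (f g : R -> X).

Lemma eq_bochner_integral D f g v : (forall x, D x -> f x = g x) ->
  is_bochner_integral D f v -> is_bochner_integral D g v.
Proof.
move=> fg [smf [s [fs fss sv]]]; split; first exact: eq_strongly_measurable smf.
exists s; split=> //; apply: eq_cvgn fss => n; apply: eq_integral => x;
  rewrite inE => Dx.
by rewrite fg.
Qed.

Lemma is_bochner_integralU D D' f v w : measurable D -> measurable D' ->
  (mu D < +oo)%E -> (mu D' < +oo)%E -> D `&` D' = set0 ->
  is_bochner_integral D f v -> is_bochner_integral D' f w ->
  is_bochner_integral (D `|` D') f (v + w).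
Proof.
move=> mD mD' Doo Doo' DD' [smf [s [fs fss sv]]] [smg [t [ft ftt tw]]].
have mU := measurableU _ _ mD mD'.
have smU : strongly_measurable (D `|` D') f.
  have := @strongly_measurable_if _ _ (D `|` D') D f f mD.
  have -> : (fun x => if `[< D x >] then f x else f x) = f.
    by apply/funext => x; case: ifP.
  apply; first by apply: sub_strongly_measurable smf => x [].
  by apply: sub_strongly_measurable smg => x [[]].
pose r n x := if `[< D x >] then s n x else t n x.
have rD n x : D x -> r n x = s n x by rewrite /r => Dx; rewrite asboolT.
have rD' n x : D' x -> r n x = t n x.
  rewrite /r => D'x; rewrite asboolF// => Dx.
  by have : (D `&` D') x by []; rewrite DD'.
have fr n : simple_function (r n) by exact: (finitely_valued_if mD (fs n)
  (ft n)).
have smr n := strongly_measurable_simple (D `|` D') (fr n).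
split=> //; exists r; split=> //.
  have -> : (fun n => (\int[mu]_(x in D `|` D') (rnorm (f x - r n x))%:E)%E) =
      (fun n => (\int[mu]_(x in D) (rnorm (f x - s n x))%:E +
                 \int[mu]_(x in D') (rnorm (f x - t n x))%:E)%E).
    apply/funext => n; rewrite ge0_integral_setU//.
    - congr (_ + _)%E; apply: eq_integral => x; rewrite inE => Dx.
        by rewrite rD.
      by rewrite rD'.
    - by apply/measurable_EFinP; exact: measurable_rnorm (strongly_measurableB
        smU (smr n)).
    - by move=> x _; rewrite lee_fin rnorm_ge0.
    - exact/disj_set2P.
  by rewrite -(adde0 0%E); exact: cvgeD.
have -> : (fun n => simple_integral (D `|` D') (r n)) =
    (fun n => simple_integral D (s n) + simple_integral D' (t n)).
  apply/funext => n; rewrite simple_integralU//.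
  by congr (_ + _); apply: eq_simple_integral => // x Dx;
    [exact: rD|exact: rD'].
exact: cvgD.
Qed.

(** Adjacent closed time intervals share an end point; this lemma removes it. *)
Lemma is_bochner_integral_ae D D' f v : measurable D -> measurable D' ->
  (mu D < +oo)%E -> D' `<=` D -> mu (D `\` D') = 0%E ->
  is_bochner_integral D f v -> is_bochner_integral D' f v.
Proof.
move=> mD mD' Doo DD' D0 [smf [s [fs fss sv]]].
have smf' := sub_strongly_measurable DD' smf.
have mB := measurableD mD mD'.
have Doo' := le_lt_trans (le_mu mD' mD DD') Doo.
have sms n := strongly_measurable_simple D (fs n).
split=> //; exists s; split=> //.
  apply: squeeze_cvge (cvg_cst 0%E) fss; apply: nearW => n; apply/andP; split.
    by apply: integral_ge0 => x _; rewrite lee_fin rnorm_ge0.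
  apply: sub_integral_real => //; last by move=> *; exact: rnorm_ge0.
  exact: measurable_rnorm (strongly_measurableB smf (sms n)).
apply: eq_cvgn sv => n.
rewrite -[in LHS](setDUK DD') simple_integralU//; last 2 first.
- by rewrite D0.
- by apply/seteqP; split=> x // [? []].
rewrite [X in _ + X](_ : _ = 0) ?addr0//.
apply/eqP; rewrite -rnorm_eq0 eq_le rnorm_ge0 andbT -lee_fin.
have B0 : (mu (D `\` D') < +oo)%E by rewrite D0.
apply: le_trans (le_simple_integral mB B0 (fs n)) _.
rewrite null_set_integral//.
apply/measurable_EFinP; apply: (measurable_rnorm (X := X)).
exact: (sub_strongly_measurable (@subDsetl _ _ _) (sms n)).
Qed.

Lemma is_bochner_integral_shift D f v (b : R) : measurable D ->
  is_bochner_integral D f v ->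
  is_bochner_integral [set x | D (x + b)] (fun x => f (x + b)) v.
Proof.
move=> mD [smf [s [fs fss sv]]]; split; first exact: strongly_measurable_shift.
have sms n := strongly_measurable_simple D (fs n).
exists (fun n x => s n (x + b)); split.
- by move=> n; exact: (finitely_valued_shift b (fs n)).
- apply: eq_cvgn fss => n; apply/esym.
  rewrite (@ge0_integral_shift _ b D (fun x => rnorm (f x - s n x)))//.
    exact: measurable_rnorm (strongly_measurableB smf (sms n)).
  by move=> *; exact: rnorm_ge0.
- apply: eq_cvgn sv => n.
  rewrite /simple_integral.
  have -> : range (fun x => s n (x + b)) = range (s n).
    apply/seteqP; split=> [_ [x _ <-]|_ [x _ <-]]; first by exists (x + b).
    by exists (x - b) => //; rewrite subrK.
  apply: eq_fsbigr => a _; congr ((fine _)%:C *: _).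
  rewrite -(lebesgue_measure_shift b)//.
  by apply: measurableI => //; exact: (fs n).2.
Qed.

End BochnerDomain.

Lemma is_bochner_integral_linear {R : realType}
    {X Y : completeNormedModType R[i]} (L : {linear X -> Y}) (D : set R)
    (f : R -> X) (v : X) :
  continuous L -> measurable D -> (mu D < +oo)%E ->
  is_bochner_integral D f v -> is_bochner_integral D (L \o f) (L v).
Proof.
move=> cL mD Doo [smf [s [fs fss sv]]].
have [C C0 LC] := continuous_linear_rnorm cL.
have smL := strongly_measurable_comp cL smf; split=> //.
have sms n := strongly_measurable_simple D (fs n).
have fL n : simple_function (L \o s n)
  by exact: (finitely_valued_comp L (fs n)).
exists (fun n => L \o s n); split=> //; last first.
  under eq_fun do rewrite simple_integral_linear//.
  apply: continuous_cvg => //; exact: cL.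
have Cf : (C%:E * \int[mu]_(x in D) (rnorm (f x - s n x))%:E)%E @[n --> \oo]
    --> 0%E.
  by rewrite -(mule0 C%:E); apply: cvgeZl.
apply: squeeze_cvge (cvg_cst 0%E) Cf; apply: nearW => n; apply/andP; split.
  by apply: integral_ge0 => x _; rewrite lee_fin rnorm_ge0.
have mfs := measurable_rnorm (strongly_measurableB smf (sms n)).
rewrite -integralZ_real//; [|by move=> *; exact: rnorm_ge0|exact: ltW].
apply: le_integral_real => //.
- exact: measurable_rnorm (strongly_measurableB smL (strongly_measurable_comp cL
    (sms n))).
- exact: measurable_funM.
- by move=> *; exact: rnorm_ge0.
- by move=> x _; rewrite /= -linearB LC.
Qed.

(** * Lebesgue norms of nonnegative real functions *)

Section AlmostEverywhere.
Context {R : realType}.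
Implicit Types P Q S : R -> Prop.

Lemma ae_mono2 P Q S : {ae mu, forall x, P x} -> {ae mu, forall x, Q x} ->
  (forall x, P x -> Q x -> S x) -> {ae mu, forall x, S x}.
Proof.
move=> aP aQ PQ; have F := ae_filter_ringOfSetsType (@lebesgue_measure R).
by apply: (@filterS2 _ _ F P Q S) aP aQ.
Qed.

Lemma ae_mono P Q : {ae mu, forall x, P x} ->
  (forall x, P x -> Q x) -> {ae mu, forall x, Q x}.
Proof. by move=> aP PQ; apply: (ae_mono2 aP aP) => x + _; exact: PQ. Qed.

Lemma ae_all P : (forall x, P x) -> {ae mu, forall x, P x}.
Proof.
move=> HP; exists set0; split; [exact: measurable0|exact: measure0|].
by move=> x /=; apply.
Qed.

Lemma ae_shift P (b : R) : {ae mu, forall x, P x} ->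
  {ae mu, forall x, P (x + b)}.
Proof.
move=> [A [mA A0 PA]]; exists [set x | A (x + b)]; split.
- exact: measurable_preimage_shift.
- by rewrite -[RHS]A0; exact: lebesgue_measure_shift.
- by move=> x /= Px; exact: PA.
Qed.

End AlmostEverywhere.

Section LnormReal.
Context {R : realType}.
Implicit Types (h g : R -> R) (p : \bar R) (C r : R).

Local Notation N p h := (Lnorm mu p (EFin \o h)).

Lemma lebesgue_measureT_gt0 : (0 < mu [set: R])%E.
Proof.
apply: lt_le_trans (le_mu (measurable_itv `[0, 1]) measurableT (@subsetT _ _)).
by rewrite lebesgue_measure_itv /= lte_fin ltr01 sube0 lte_fin.
Qed.

(** Together with [Lnorm_oo_le] this replaces a bound on the norm by a bound
on an integral or by an almost everywhere bound; the estimates below that treat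
all exponents at once split into these two cases. *)
Lemma Lnorm_fin_le r h C : 1 <= r -> 0 <= C -> (forall x, 0 <= h x) ->
  (N r%:E h <= C%:E)%E = (\int[mu]_x (h x `^ r)%:E <= (C `^ r)%:E)%E.
Proof.
move=> r1 C0 h0; have r0 : 0 < r by exact: lt_le_trans r1.
have -> : (\int[mu]_x (h x `^ r)%:E = N r%:E h `^ r)%E.
  rewrite poweR_Lnorm ?gt_eqF//; apply: eq_integral => x _ /=.
  by rewrite ger0_norm.
rewrite -poweR_EFin.
have I (x : \bar R) : (0 <= x)%E -> x \in `[0%E, +oo%E].
  by move=> x0; rewrite in_itv /= x0 leey.
apply/idP/idP => [NC|].
  by apply: gt0_ler_poweR => //; [exact: ltW|exact/I/Lnorm_ge0|exact: I].
have r0' : 0 <= r^-1 by rewrite invr_ge0 ltW.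
move=> /(gt0_ler_poweR r0' (I _ (poweR_ge0 _ _)) (I _ (poweR_ge0 _ _))).
by rewrite -!poweRrM mulfV ?gt_eqF// !poweRe1// Lnorm_ge0.
Qed.

Lemma Lnorm_oo_le h C : (forall x, 0 <= h x) ->
  (N +oo h <= C%:E)%E <-> {ae mu, forall x, h x <= C}.
Proof.
move=> h0; rewrite unlock lebesgue_measureT_gt0.
have E : {ae mu, forall x, h x <= C} <->
    {ae mu, forall x, ((abse \o (EFin \o h)) x <= C%:E)%E}.
  by split=> H; apply: (ae_mono H) => x; rewrite /= lee_fin ger0_norm.
by split=> [/ess_supP/E|/E/ess_supP].
Qed.

Lemma integral_cst_fin (D : set R) C : measurable D -> (mu D < +oo)%E ->
  (\int[mu]_(x in D) C%:E = (C * fine (mu D))%:E)%E.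
Proof.
move=> mD Doo; rewrite integral_cst; last exact: mD.
by rewrite EFinM fineK// ge0_fin_numE.
Qed.

(** Reduces a comparison of norms to bounds by real constants, disposing of
infinite norms. *)
Lemma Lnorm_le_transfer p h g :
  (forall C, 0 <= C -> (N p g <= C%:E)%E -> (N p h <= C%:E)%E) ->
  (N p h <= N p g)%E.
Proof.
move=> H; have [Ngoo|] := eqVneq (N p g) +oo%E; first by rewrite Ngoo leey.
rewrite -ltey -ge0_fin_numE ?Lnorm_ge0// => Nfin.
rewrite -(fineK Nfin); apply: H; rewrite ?fineK// fine_ge0//.
exact: Lnorm_ge0.
Qed.

Lemma measurable_fun_powR_real h r : measurable_fun setT h ->
  measurable_fun setT (fun x => h x `^ r).
Proof. by move=> mh; apply: (measurableT_comp (measurable_powR r) mh). Qed.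

Lemma le_Lnorm p h g : (1 <= p)%E ->
  measurable_fun setT h -> measurable_fun setT g ->
  (forall x, 0 <= h x) -> (forall x, 0 <= g x) ->
  {ae mu, forall x, h x <= g x} -> (N p h <= N p g)%E.
Proof.
move=> p1 mh mg h0 g0 hg; apply: Lnorm_le_transfer => C C0.
case: p p1 => [r|_|//]; [rewrite lee_fin => r1|].
  rewrite !Lnorm_fin_le//; apply: le_trans.
  apply: ae_ge0_le_integral => //.
  - by move=> x _; rewrite lee_fin powR_ge0.
  - by apply/measurable_EFinP; exact: measurable_fun_powR_real.
  - by move=> x _; rewrite lee_fin powR_ge0.
  - by apply/measurable_EFinP; exact: measurable_fun_powR_real.
  - apply: (ae_mono hg) => x hgx _; rewrite lee_fin.
    by rewrite ge0_ler_powR ?nnegrE// (le_trans _ r1).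
move=> /Lnorm_oo_le -/(_ g0) gC; apply/Lnorm_oo_le => //.
by apply: (ae_mono2 hg gC) => x; exact: le_trans.
Qed.

Lemma LnormD_le p h g : (1 <= p)%E ->
  measurable_fun setT h -> measurable_fun setT g ->
  (N p (fun x => (h x + g x)%R) <= N p h + N p g)%E.
Proof. by move=> p1 mh mg; exact: eminkowski. Qed.

Lemma LnormZ_le p h C : (1 <= p)%E -> measurable_fun setT h ->
  (forall x, 0 <= h x) -> 0 <= C ->
  (N p (fun x => (C * h x)%R) <= C%:E * N p h)%E.
Proof.
move=> p1 mh h0; rewrite le_eqVlt => /predU1P[<-|C0].
  rewrite mul0e; under eq_Lnorm do rewrite /= mul0r.
  by rewrite (@Lnorm0 _ _ _ mu p)// gt_eqF// (lt_le_trans _ p1).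
have Ch0 x : 0 <= C * h x by rewrite mulr_ge0// ltW.
have [Noo|] := eqVneq (N p h) +oo%E.
  by rewrite Noo gt0_muley ?lte_fin// leey.
rewrite -ltey -ge0_fin_numE ?Lnorm_ge0// => Nfin.
have {Nfin} NE := fineK Nfin; rewrite -NE -EFinM.
have n0 : 0 <= fine (N p h) by apply: fine_ge0; exact: Lnorm_ge0.
have : (N p h <= (fine (N p h))%:E)%E by rewrite NE.
move: (fine _) n0 {NE} => n n0; case: p p1 => [r|_|//];
  [rewrite lee_fin => r1|].
  rewrite !Lnorm_fin_le// ?mulr_ge0 ?(ltW C0)// powRM ?(ltW C0)// => hn.
  under eq_integral do rewrite powRM ?(ltW C0)//.
  rewrite (@integralZ_real _ setT) ?powR_ge0//.
  - by rewrite EFinM lee_pmul2l ?lte_fin ?powR_gt0.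
  - exact: measurable_fun_powR_real.
  - by move=> x _; exact: powR_ge0.
move=> /Lnorm_oo_le -/(_ h0) hn; apply/Lnorm_oo_le => //.
by apply: (ae_mono hn) => x; rewrite ler_pM2l.
Qed.

Lemma Lnorm_shift_le p h (b : R) : (1 <= p)%E -> measurable_fun setT h ->
  (forall x, 0 <= h x) -> (N p (fun x => h (x + b)%R) <= N p h)%E.
Proof.
move=> p1 mh h0; apply: Lnorm_le_transfer => C C0.
case: p p1 => [r|_|//]; [rewrite lee_fin => r1|].
  rewrite !Lnorm_fin_le//; apply: le_trans.
  rewrite -(@ge0_integral_shift _ b setT (fun x => h x `^ r))//.
    exact: measurable_fun_powR_real.
  by move=> *; exact: powR_ge0.
move=> /Lnorm_oo_le -/(_ h0) hC; apply/Lnorm_oo_le => //.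
exact: (ae_shift b hC).
Qed.

Lemma Lnorm_indic_le p (D : set R) C : (1 <= p)%E -> measurable D ->
  (mu D < +oo)%E -> 0 <= C ->
  (N p (fun x => (C * \1_D x)%R) <= (C * (1 + fine (mu D)))%:E)%E.
Proof.
move=> p1 mD Doo C0; have m0 : 0 <= fine (mu D) by apply: fine_ge0.
have I0 x : 0 <= (\1_D x : R) by rewrite indicE.
have mI : measurable_fun setT (\1_D : R -> R) by exact: measurable_indic.
apply: le_trans (LnormZ_le p1 mI I0 C0) _.
rewrite EFinM; apply: lee_wpmul2l; rewrite ?lee_fin//.
case: p p1 => [r|_|//]; [rewrite lee_fin => r1|].
  rewrite Lnorm_fin_le ?addr_ge0//.
  have -> : (\int[mu]_x (\1_D x `^ r)%:E = mu D)%E.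
    rewrite -[in RHS](setIT D) -integral_indic//.
    apply: eq_integral => x _; rewrite indicE; case: (_ \in _).
      by rewrite powR1.
    by rewrite powR0// gt_eqF// (lt_le_trans _ r1).
  rewrite -(@fineK _ (mu D)) ?ge0_fin_numE// lee_fin.
  by apply: le_trans (le1r_powR _ r1); lra.
apply/Lnorm_oo_le => //; apply: aeW => x; rewrite indicE.
by case: (_ \in _) => /=; lra.
Qed.

(** A form of the Hoelder inequality with a crude constant.  For finite [r] it
only needs [x <= 1 + x `^ r], applied to [h x / n] where [n] bounds the norm. *)
Lemma integral_le_Lnorm p (D : set R) h : (1 <= p)%E -> measurable D ->
  (mu D < +oo)%E -> measurable_fun setT h -> (forall x, 0 <= h x) ->
  (\int[mu]_(x in D) (h x)%:E <= (1 + mu D) * N p h)%E.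
Proof.
move=> p1 mD Doo mh h0; have m0 : 0 <= fine (mu D) by apply: fine_ge0.
have muE : mu D = (fine (mu D))%:E by rewrite fineK// ge0_fin_numE.
have [Noo|] := eqVneq (N p h) +oo%E.
  by rewrite Noo gt0_muley ?leey// muE -EFinD lte_fin ltr_pwDl.
rewrite -ltey -ge0_fin_numE ?Lnorm_ge0// => Nfin.
have n0 : 0 <= fine (N p h) by apply: fine_ge0; exact: Lnorm_ge0.
rewrite -(fineK Nfin) muE -EFinD -EFinM.
(* any bound [n > 0] of the norm will do, so the norm itself may vanish *)
suff H n : 0 < n -> (N p h <= n%:E)%E ->
    (\int[mu]_(x in D) (h x)%:E <= ((1 + fine (mu D)) * n)%:E)%E.
  apply/lee_addgt0Pr => e e0; rewrite -EFinD.
  have d0 : 0 < e / (1 + fine (mu D)) by rewrite divr_gt0// ltr_pwDl.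
  apply: le_trans (H (fine (N p h) + e / (1 + fine (mu D))) _ _) _.
  - by rewrite ltr_wpDl.
  - by rewrite EFinD fineK// leeDl// lee_fin ltW.
  - by rewrite lee_fin mulrDr [X in _ + X]mulrC divfK// gt_eqF// ltr_pwDl.
move=> np; case: p p1 {Nfin n0} => [r|_|//]; [rewrite lee_fin => r1|].
  rewrite Lnorm_fin_le ?(ltW np)// => hn.
  have mr : measurable_fun setT (fun x =>
    h x `^ r) by exact: measurable_fun_powR_real.
  have c0 : 0 <= n * (n `^ r)^-1 by rewrite mulr_ge0 ?invr_ge0 ?powR_ge0 ?ltW.
  apply: (@le_trans _ _ (\int[mu]_(x in D)
    (n + n * (n `^ r)^-1 * h x `^ r)%:E)%E).
    apply: le_integral_real => //.
    - exact: measurable_funTS.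
    - apply: measurable_funD => //; apply: measurable_funM => //.
      exact: measurable_funTS.
    - move=> x _; have hE : h x = n * (h x / n) by rewrite mulrC divfK ?gt_eqF.
      have q0 : 0 <= h x / n by rewrite divr_ge0// ltW.
      have -> : n * (n `^ r)^-1 * h x `^ r = n * (h x / n) `^ r.
        rewrite {1}hE (powRM r (ltW np) q0) mulrA divfK// gt_eqF// powR_gt0//.
      rewrite {1}hE; have -> : n + n * (h x / n) `^ r = n * (1 + (h x / n)
        `^ r).
        by rewrite mulrDr mulr1.
      rewrite ler_pM2l//.
      have [q1|q1] := leP (h x / n) 1.
        by have := powR_ge0 (h x / n) r; lra.
      by have := le1r_powR (ltW q1) r1; lra.
  rewrite integralD_real; [|exact: mD|by []| |by move=> *; exact: ltW|];
    last 2 first.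
  - by apply: measurable_funM => //; exact: measurable_funTS.
  - by move=> *; rewrite mulr_ge0 ?powR_ge0.
  rewrite integral_cst_fin// integralZ_real//; last 2 first.
  - exact: measurable_funTS.
  - by move=> *; exact: powR_ge0.
  have -> : (1 + fine (mu D)) * n = n * fine (mu D) + n by ring.
  rewrite EFinD; apply: leeD2l.
  apply: (@le_trans _ _ ((n * (n `^ r)^-1)%:E * (n `^ r)%:E)%E).
    rewrite lee_wpmul2l ?lee_fin//; apply: le_trans hn.
    by apply: sub_integral_real => // x _; exact: powR_ge0.
  by rewrite -EFinM divfK// gt_eqF// powR_gt0.
move=> /Lnorm_oo_le -/(_ h0) hn.
apply: (@le_trans _ _ (\int[mu]_(x in D) n%:E)%E).
  apply: ae_ge0_le_integral => //.
  - by move=> *; rewrite lee_fin.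
  - by apply/measurable_EFinP; exact: measurable_funTS.
  - by move=> *; rewrite lee_fin ltW.
  - by apply: (ae_mono hn) => x hx _; rewrite lee_fin.
rewrite integral_cst_fin// lee_fin mulrC ler_pM2r//; lra.
Qed.

End LnormReal.

(** * Lebesgue norms along a countable partition *)

Section PowerSums.
Context {R : realType}.
Implicit Types (r rho x y : R).

Lemma powR_convex r rho x y : 1 <= r -> 0 <= rho <= 1 -> 0 <= x -> 0 <= y ->
  (rho * x + (1 - rho) * y) `^ r <= rho * x `^ r + (1 - rho) * y `^ r.
Proof.
move=> r1 /andP[h0 h1] x0 y0.
have := @convex_powR R r r1 (Itv01 h0 h1) x y.
rewrite !inE /= !in_itv /= !andbT => /(_ x0 y0).
by rewrite !convRE.
Qed.

(** Discrete Young inequality for the kernel [rho ^ k]: by convexity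
[b k.+1 ^ r <= rho * b k ^ r + (1 - rho) * (a k.+1 / (1 - rho)) ^ r], and
summing over [k] lets the first term be absorbed on the left. *)
Lemma geometric_young r rho (a b : nat -> R) n : 1 <= r -> 0 <= rho < 1 ->
  (forall k, 0 <= a k) -> b 0%N = a 0%N ->
  (forall k, b k.+1 = rho * b k + a k.+1) ->
  \sum_(k < n) b k `^ r <= (1 - rho)^-1 `^ r * \sum_(k < n) a k `^ r.
Proof.
move=> r1 /andP[rho0 rho1] a0 b0 bS.
have s0 : 0 < 1 - rho by rewrite subr_gt0.
have bk0 k : 0 <= b k.
  by elim: k => [|k IH]; rewrite ?b0// bS addr_ge0// mulr_ge0.
pose A k := (a k / (1 - rho)) `^ r.
have ak0 k : 0 <= a k / (1 - rho) by rewrite divr_ge0// ltW.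
have rho01 : 0 <= rho <= 1 by rewrite rho0 ltW.
have step k x : 0 <= x ->
    (rho * x + a k) `^ r <= rho * x `^ r + (1 - rho) * A k.
  move=> x0; rewrite -[in leLHS](divfK (lt0r_neq0 s0) (a k)) [_ / _ * _]mulrC.
  exact: powR_convex.
have H m : \sum_(k < m.+1) b k `^ r <=
    rho * (\sum_(k < m) b k `^ r) + (1 - rho) * \sum_(k < m.+1) A k.
  elim: m => [|m IH].
    rewrite !big_ord1 big_ord0 mulr0 b0.
    have := step 0%N 0 (lexx _); rewrite mulr0 !add0r.
    by rewrite powR0 ?mulr0 ?add0r// gt_eqF// (lt_le_trans _ r1).
  rewrite big_ord_recr /= bS.
  rewrite [X in _ <= _ * X + _]big_ord_recr [X in _ <=
    _ + _ * X]big_ord_recr /=.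
  by have := step m.+1 (b m) (bk0 m); rewrite !mulrDr; lra.
case: n => [|m]; first by rewrite !big_ord0 mulr0.
have -> : (1 - rho)^-1 `^ r * \sum_(k < m.+1) a k `^ r = \sum_(k < m.+1) A k.
  rewrite mulr_sumr; apply: eq_bigr => k _;
    rewrite -powRM ?invr_ge0 ?(ltW s0)//.
  by rewrite mulrC.
rewrite -(ler_pM2l s0) mulrBl mul1r lerBlDl; apply: le_trans (H m) _.
rewrite lerD2r ler_wpM2l// big_ord_recr /= lerDl; exact: powR_ge0.
Qed.

End PowerSums.

Section LnormPieces.
Context {R : realType}.
Implicit Types (h g v : R -> R) (p : \bar R) (K : R -> nat).

Local Notation N p h := (Lnorm mu p (EFin \o h)).

Lemma measurable_restrict_indic (D : set R) h : measurable D ->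
  measurable_fun setT h -> measurable_fun setT (fun x => \1_D x * h x).
Proof. by move=> mD mh; apply: measurable_funM => //;
  exact: measurable_indic. Qed.

Lemma indic_mul_ge0 (D : set R) h x : (forall x, 0 <= h x) -> 0 <= \1_D x * h x.
Proof. by move=> h0; rewrite mulr_ge0// indicE. Qed.

Lemma Lnorm_monotone_le p (D : nat -> set R) h (C : R) : (1 <= p)%E ->
  (forall n, measurable (D n)) -> (forall n, D n `<=` D n.+1) ->
  (forall x, exists n, D n x) ->
  measurable_fun setT h -> (forall x, 0 <= h x) -> 0 <= C ->
  (forall n, N p (fun x => (\1_(D n) x * h x)%R) <= C%:E)%E ->
    (N p h <= C%:E)%E.
Proof.
move=> p1 mD DS Dx mh h0 C0.
have Dh0 n x : 0 <= \1_(D n) x * h x by exact: indic_mul_ge0.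
case: p p1 => [r|_|//] => [|NC]; last first.
  have aC n := (Lnorm_oo_le C (Dh0 n)).1 (NC n).
  apply/Lnorm_oo_le => //.
  apply: (ae_mono (ae_foralln aC)) => x xC; have [n Dnx] := Dx x.
  by have := xC n; rewrite indicE mem_set// mul1r.
rewrite lee_fin => r1 NC; rewrite Lnorm_fin_le//.
have Dm n m x : (n <= m)%N -> D n x -> D m x.
  by move=> /subnKC <-; elim: (m - n)%N => [|k IH];
    rewrite ?addn0// addnS => /IH/DS.
pose g n x := ((\1_(D n) x * h x) `^ r)%:E.
have gh x : g n x @[n --> \oo] --> (h x `^ r)%:E.
  have [n Dnx] := Dx x; apply: cvg_near_cst; exists n => // m /= nm.
  by rewrite /g indicE mem_set ?mul1r//; exact: Dm nm Dnx.
have mg n : measurable_fun setT (g n).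
  apply/measurable_EFinP; apply: measurable_fun_powR_real.
  exact: measurable_restrict_indic.
have := @cvg_monotone_convergence _ _ _ mu setT measurableT g mg.
have g0 n x : setT x -> (0 <= g n x)%E by move=> _; rewrite lee_fin powR_ge0.
move=> /(_ g0) H; have {}H := H _.
have gl : (\int[mu]_x g n x)%E @[n --> \oo] --> (\int[mu]_x (h x `^ r)%:E)%E.
  have -> : (\int[mu]_x (h x `^ r)%:E)%E = (\int[mu]_x limn (g^~ x))%E.
    by apply: eq_integral => x _; rewrite (cvg_lim _ (gh x)).
  apply: H => x _ n m nm; rewrite lee_fin ge0_ler_powR ?nnegrE ?(le_trans _
    r1)//.
  rewrite ler_wpM2r// !indicE ler_nat; case: (boolP (_ \in D n)) => //.
  by rewrite inE => Dnx; rewrite mem_set//; exact: Dm nm Dnx.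
apply: (lee_cvg_to gl (cvg_cst _)); apply: nearW => n.
by rewrite -Lnorm_fin_le.
Qed.

(** By the triangle inequality the first [n] pieces contribute at most
[2 * C - 2 * C / 2 ^+ n]; monotone convergence then exhausts the line. *)
Lemma Lnorm_geometric_le p K h (C : R) : (1 <= p)%E ->
  (forall k, measurable [set x | K x = k]) ->
  measurable_fun setT h -> (forall x, 0 <= h x) -> 0 <= C ->
  (forall k, N p (fun x => (\1_[set y | K y = k] x * h x)%R) <=
    (C / 2 ^+ k)%:E)%E ->
  (N p h <= (2 * C)%:E)%E.
Proof.
move=> p1 mK mh h0 C0 hC.
pose D n := [set x | (K x < n)%N].
have mD n : measurable (D n).
  have -> : D n = \bigcup_(k in [set k | (k < n)%N]) [set x | K x = k].
    apply/seteqP; split=> x /=; first by move=> xn; exists (K x).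
    by move=> [k kn Kx]; rewrite /D /= Kx.
  apply: fin_bigcup_measurable => [|k _]; [exact: finite_II|exact: mK].
apply: (@Lnorm_monotone_le p D) => //.
- by move=> n x; rewrite /D /=; exact: leqW.
- by move=> x; exists (K x).+1; rewrite /D /=.
- by rewrite mulr_ge0.
move=> n; apply: (@le_trans _ _ (2 * C - 2 * C / 2 ^+ n)%:E); last first.
  by rewrite lee_fin gerBl divr_ge0 ?mulr_ge0// exprn_ge0.
elim: n => [|n IH].
  rewrite expr0 divr1 subrr.
  under eq_Lnorm => x do rewrite /= indicE memNset ?mul0r//.
  by rewrite (@Lnorm0 _ _ _ mu p)// gt_eqF// (lt_le_trans _ p1).
have -> : 2 * C - 2 * C / 2 ^+ n.+1 = (2 * C - 2 * C / 2 ^+ n) + C / 2 ^+ n.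
  by rewrite exprS; field; rewrite ?expf_neq0.
have E x : \1_(D n.+1) x * h x =
    \1_(D n) x * h x + \1_[set y | K y = n] x * h x.
  rewrite -mulrDl; congr (_ * _); rewrite !indicE -natrD; congr (_%:R).
  have -> : (x \in [set y | K y = n]) = (K x == n).
    by apply/idP/eqP; rewrite inE.
  have inD m : (x \in D m) = (K x < m)%N by apply/idP/idP; rewrite inE.
  by rewrite !inD ltnS leq_eqVlt; case: ltngtP.
under eq_Lnorm => x do rewrite /= E.
rewrite EFinD; apply: le_trans (leeD IH (hC n)).
by apply: LnormD_le => //; exact: measurable_restrict_indic.
Qed.

End LnormPieces.

(** * Young inequality for norms over blocks *)

Section BlockYoung.
Context {R : realType}.
Implicit Types (h v : R -> R) (p : \bar R) (K : R -> nat).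

Local Notation N p h := (Lnorm mu p (EFin \o h)).

Lemma Lnorm_fin_ge (r : R) h (C : R) : 1 <= r -> 0 <= C ->
  (forall x, 0 <= h x) -> (C%:E <= N r%:E h)%E ->
  ((C `^ r)%:E <= \int[mu]_x (h x `^ r)%:E)%E.
Proof.
move=> r1 C0 h0 CN; have r0 : 0 < r by exact: lt_le_trans r1.
have -> : (\int[mu]_x (h x `^ r)%:E = N r%:E h `^ r)%E.
  rewrite poweR_Lnorm ?gt_eqF//; apply: eq_integral => x _ /=.
  by rewrite ger0_norm.
rewrite -poweR_EFin; apply: gt0_ler_poweR => //; first exact: ltW.
  by rewrite in_itv /= lee_fin C0 leey.
by rewrite in_itv /= Lnorm_ge0 leey.
Qed.

Lemma sum_indic_fiber K h (n : nat) x :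
  \sum_(k < n) \1_[set y | K y = k] x * h x = if (K x < n)%N then h x else 0.
Proof.
have E (k : nat) : \1_[set y | K y = k] x = (K x == k)%:R :> R.
  by rewrite indicE; congr (_%:R); congr nat_of_bool; apply/idP/eqP;
    rewrite inE.
case: ifPn => [Kn|]; last first.
  rewrite -leqNgt => nK; rewrite big1// => k _; rewrite E gtn_eqF ?mul0r//.
  exact: leq_trans (ltn_ord k) nK.
rewrite (bigD1 (Ordinal Kn))//= E eqxx mul1r big1 ?addr0// => k kK.
by rewrite E [_ == _](_ : _ = false) ?mul0r//;
  apply: contra_neqF kK => /eqP Kk; apply/val_inj.
Qed.

(** The norm over consecutive blocks is an [l^p] norm of the norms over the
single blocks, which turns a recursive estimate of the latter into an estimate
of the former by the discrete Young inequality. *)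
Lemma Lnorm_block_young p K h v (c rho C : R) (a b : nat -> R) (n : nat) :
  (1 <= p)%E -> (forall k, measurable [set x | K x = k]) ->
  measurable_fun setT h -> measurable_fun setT v ->
  (forall x, 0 <= h x) -> (forall x, 0 <= v x) ->
  0 <= c -> 0 <= rho < 1 ->
  (forall x, (n <= K x)%N -> h x = 0) ->
  (forall k, 0 <= a k) -> b 0%N = a 0%N ->
  (forall k, b k.+1 = rho * b k + a k.+1) ->
  (forall k, (a k)%:E <= N p (fun x => (\1_[set y | K y = k] x * v x)%R))%E ->
  (forall k, N p (fun x => (\1_[set y | K y = k] x * h x)%R) <=
    (c * b k)%:E)%E ->
  0 <= C -> (N p v <= C%:E)%E -> (N p h <= (c / (1 - rho) * C)%:E)%E.
Proof.
move=> p1 mK mh mv h0 v0 c0 /[dup] rho01 /andP[rho0 rho1] hn a0 b0 bS aN hN C0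
  vC.
have s0 : 0 < 1 - rho by rewrite subr_gt0.
have bk0 k : 0 <= b k.
  by elim: k => [|k IH]; rewrite ?b0// bS addr_ge0// mulr_ge0.
pose Kh k x := \1_[set y | K y = k] x * h x.
pose Kv k x := \1_[set y | K y = k] x * v x.
have Kh0 k x : 0 <= Kh k x by exact: indic_mul_ge0.
have Kv0 k x : 0 <= Kv k x by exact: indic_mul_ge0.
have mKh k : measurable_fun setT (Kh k) by exact: measurable_restrict_indic.
have mKv k : measurable_fun setT (Kv k) by exact: measurable_restrict_indic.
have KvE k x : Kv k x <= v x.
  by rewrite /Kv ler_piMl// indicE; case: (_ \in _).
have cs0 : 0 <= c / (1 - rho) by rewrite divr_ge0// ltW.
case: p p1 aN hN vC => [r|_|//] => [|aN hN vC]; last first.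
  have aC k : a k <= C.
    rewrite -lee_fin; apply: le_trans (aN k) _; apply: le_trans vC.
    apply: (le_Lnorm (leey _) (mKv k) mv (Kv0 k) v0).
    by apply: ae_all => x; exact: KvE.
  have bC k : b k <= C / (1 - rho).
    rewrite ler_pdivlMr//; elim: k => [|k IH].
      rewrite b0 (le_trans _ (aC 0%N))// ler_piMr// gerBl//.
    rewrite bS; have : rho * (b k * (1 - rho)) <= rho * C.
      by rewrite ler_wpM2l.
    have : 0 <= (C - a k.+1) * (1 - rho)
      by rewrite mulr_ge0 ?subr_ge0 ?aC ?(ltW rho1).
    by lra.
  apply/Lnorm_oo_le => //.
  have Kae k : {ae mu, forall x, Kh k x <= c / (1 - rho) * C}.
    apply/Lnorm_oo_le => //; apply: le_trans (hN k) _.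
    by rewrite lee_fin mulrAC -mulrA ler_wpM2l.
  apply: (ae_mono (ae_foralln Kae)) => x /(_ (K x)).
  by rewrite /Kh indicE mem_set ?mul1r.
have csC0 : 0 <= c / (1 - rho) * C by rewrite mulr_ge0 ?cs0.
rewrite lee_fin => r1 aN hN; rewrite !Lnorm_fin_le// => vC.
have r0 : 0 < r by exact: lt_le_trans r1.
have hE x : h x `^ r <= \sum_(k < n) Kh k x `^ r.
  have -> : h x `^ r = \sum_(k < n) \1_[set y | K y = k] x * h x `^ r.
    rewrite (sum_indic_fiber K (fun y => h y `^ r)).
    by case: ltnP => // /hn ->; rewrite powR0// gt_eqF.
  apply: ler_sum => k _; rewrite /Kh indicE; case: (_ \in _).
    by rewrite !mul1r.
  by rewrite mul0r powR_ge0.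
have vE x : \sum_(k < n) Kv k x `^ r <= v x `^ r.
  have E k : Kv k x `^ r = \1_[set y | K y = k] x * v x `^ r.
    rewrite /Kv indicE; case: (_ \in _); first by rewrite !mul1r.
    by rewrite !mul0r powR0// gt_eqF.
  under eq_bigr do rewrite E.
  rewrite (sum_indic_fiber K (fun y => v y `^ r)).
  by case: ifP => // _; exact: powR_ge0.
have msum (f : nat -> R -> R) : (forall k, measurable_fun setT (f k)) ->
    measurable_fun setT (fun x => \sum_(k < n) f k x `^ r).
  by move=> mf; apply: measurable_sum => k; exact: measurable_fun_powR_real.
have isum (f : nat -> R -> R) : (forall k, measurable_fun setT (f k)) ->
    (\int[mu]_x (\sum_(k < n) f k x `^ r)%:E =
     \sum_(k < n) \int[mu]_x (f k x `^ r)%:E)%E.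
  move=> mf; under eq_integral do rewrite -sumEFin.
  rewrite ge0_integral_sum// => [k|k x _]; last by rewrite lee_fin powR_ge0.
  by apply/measurable_EFinP; exact: measurable_fun_powR_real.
apply: (@le_trans _ _ (\int[mu]_x (\sum_(k < n) Kh k x `^ r)%:E)%E).
  apply: le_integral_real => //.
  - exact: measurable_fun_powR_real.
  - exact: msum.
  - by move=> *; exact: powR_ge0.
rewrite isum//.
apply: (@le_trans _ _ (\sum_(k < n) ((c * b k) `^ r)%:E)%E).
  apply: lee_sum => k _; rewrite -Lnorm_fin_le ?mulr_ge0//; exact: hN.
have {}vC : \sum_(k < n) a k `^ r <= C `^ r.
  rewrite -lee_fin -sumEFin; apply: le_trans vC.
  apply: (@le_trans _ _ (\sum_(k < n) \int[mu]_x (Kv k x `^ r)%:E)%E).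
    by apply: lee_sum => k _; apply: Lnorm_fin_ge => //; exact: aN.
  rewrite -isum//; apply: le_integral_real => //.
  - exact: msum.
  - exact: measurable_fun_powR_real.
  - by move=> x _; apply: sumr_ge0 => k _; exact: powR_ge0.
rewrite sumEFin lee_fin.
under eq_bigr do rewrite powRM//.
rewrite -mulr_sumr !powRM ?invr_ge0 ?(ltW s0)// -mulrA ler_wpM2l ?powR_ge0//.
apply: le_trans (geometric_young n r1 rho01 a0 b0 bS) _.
by rewrite ler_wpM2l ?powR_ge0.
Qed.

End BlockYoung.

(** * Semigroup, resolvent and extrapolation space *)

Section Operators.
Context {R : realType} {X Xm1 : completeNormedModType R[i]}.
Context (T : R -> {linear X -> X}) (A : @unbounded_operator R X).
Context (lambda : R[i]) (Rl : {linear X -> X}).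
Context (j : {linear X -> Xm1}) (Tm1 : R -> {linear Xm1 -> Xm1}).
Context (T_C0 : C0_semigroup T) (A_gen : is_generator T A).
Context (lambda_res : is_resolvent A lambda Rl).
Context (Xm1_extrapolation : is_extrapolation T Rl j Tm1).

(** [T h] commutes with [T t], hence with the difference quotients. *)
Lemma generator_semigroup (t : R) (y : X) : 0 <= t -> opdom A y ->
  opdom A (T t y) /\ A (T t y) = T t (A y).
Proof.
have [Tc T0 TD _] := T_C0.
move=> t0 yA; apply/A_gen; have /A_gen := conj yA (erefl (A y)).
move=> /(continuous_cvg _ (Tc t t0 _)); apply: cvg_trans; apply: near_eq_cvg.
near=> h; have h0 : 0 <= h by apply: ltW; near: h; exact: nbhs_right_gt.
by rewrite /= linearZ linearB /= -!TD// (addrC h).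
Unshelve. all: by end_near. Qed.

Lemma resolvent_semigroup (t : R) (x : X) : 0 <= t -> Rl (T t x) = T t (Rl x).
Proof.
have [_ RA RB] := lambda_res.
move=> t0; have [dx xE] := RA x.
have [dTx TxE] := generator_semigroup t0 dx.
by rewrite -[in RHS](RB _ dTx) TxE -linearZ -linearB /= xE.
Qed.

Lemma extrapolation_rnorm (x : X) : rnorm (j x) = rnorm (Rl x).
Proof. by rewrite /rnorm; have [-> _ _ _] := Xm1_extrapolation. Qed.

Lemma continuous_extrapolation : continuous j.
Proof.
have [Rc _ _] := lambda_res; have [C _ RC] := continuous_linear_rnorm Rc.
by apply: (@bounded_linear_rnorm _ _ _ j C) => v; rewrite extrapolation_rnorm.
Qed.

(** On the range of [j] the bound is that of [T], because the resolvent
commutes with [T] and [j] carries the norm of [Rl]; density does the rest. *)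
Lemma extrapolated_semigroup_le (M omega : R) : 0 < M ->
  (forall t x, 0 <= t -> rnorm (T t x) <= M * expR (- omega * t) * rnorm x) ->
  forall t y, 0 <= t -> rnorm (Tm1 t y) <= M * expR (- omega * t) * rnorm y.
Proof.
move=> M0 TM t y t0; have [_ dj [Tc _ _ _] jT] := Xm1_extrapolation.
have [C C0 TC] := continuous_linear_rnorm (Tc t t0).
set K := M * _; have K0 : 0 < K by rewrite mulr_gt0// expR_gt0.
apply/ler_addgt0Pr => e e0.
have d0 : 0 < e / (C + K) by rewrite divr_gt0// addr_gt0.
have [x yx] := dense_rnorm y dj d0.
have jx : rnorm (Tm1 t (j x)) <= K * rnorm (j x).
  by rewrite jT// !extrapolation_rnorm resolvent_semigroup// TM.
have h1 := TC (y - j x).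
have h2 := rnormD (Tm1 t (y - j x)) (Tm1 t (j x)).
rewrite -linearD /= subrK in h2.
have h3 : rnorm (j x) <= rnorm y + rnorm (y - j x).
  by rewrite rnorm_distC -{1}(subrK y (j x)) addrC rnormD.
have h4 : (C + K) * rnorm (y - j x) <= e.
  by rewrite mulrC -ler_pdivlMr ?addr_gt0// ltW.
have h5 : K * rnorm (j x) <= K * (rnorm y + rnorm (y - j x))
  by rewrite ler_pM2l.
by move: (rnorm (y - j x)) h1 h2 h4 h5 => r; lra.
Qed.

(** Let [S'] be the derivative of the analytic extension at [a].  On the domain
of [A], both [T a (A y)] and [S' y] are the limit of the difference quotients
of [T] at [a], so [T a A] extends to the bounded map [S'].  Applied to
[x = (lambda - A) (Rl x)], this gives
[T a x = lambda *: T a (Rl x) - S' (Rl x)]. *)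
Lemma analytic_smoothing (a : R) : analytic_semigroup T -> 0 < a ->
  exists2 C : R, 0 < C & forall x, rnorm (T a x) <= C * rnorm (j x).
Proof.
move=> [theta [S [/andP[th0 _] [ST _ _ Sh _]]]] a0.
have [Tc T0 TD _] := T_C0.
have [_ RA RB] := lambda_res.
have sa : sector theta a%:C.
  by exists a, 0; rewrite normr0 cos0 sin0 mulr1 mulr0.
have [S' S'c S'h] := Sh _ sa.
have TA y : opdom A y -> T a (A y) = S' y.
  move=> dy; have /A_gen /(continuous_cvg _ (Tc a (ltW a0) _)) h :=
    conj dy (erefl (A y)).
  apply: (cvg_unique _ h); first exact: norm_hausdorff.
  apply/rnorm_cvgP/cvgrPdist_le => e e0.
  have e0' : 0 < e / (1 + rnorm y).
    by rewrite divr_gt0// ltr_wpDr ?rnorm_ge0.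
  have [d d0 dP] := S'h _ e0'.
  near=> t; have t0 : 0 < t by near: t; exact: nbhs_right_gt.
  have td : t < d by near: t; exact: nbhs_right_lt.
  have := dP t%:C y; rewrite rnorm_real gtr0_norm// => /(_ _ td).
  rewrite -rmorphD !ST ?addr_ge0 ?(ltW a0) ?(ltW t0)//.
  have -> : t%:C != 0 by rewrite eq_complex /= eqxx andbT gt_eqF.
  move=> /(_ isT) h1.
  rewrite sub0r normrN ger0_norm ?rnorm_ge0//.
  rewrite /= linearZ linearB /= -TD ?(ltW a0) ?(ltW t0)//.
  apply: le_trans h1 _; rewrite mulrAC ler_pdivrMr ?ltr_wpDr ?rnorm_ge0//.
  by rewrite ler_pM2l// lerDr.
have [C1 C10 TC] := continuous_linear_rnorm (Tc a (ltW a0)).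
have [C2 C20 S'C] := continuous_linear_rnorm S'c.
exists (rnorm lambda * C1 + C2).
  apply: ltr_wpDl => //; apply: mulr_ge0; last exact: ltW.
  exact: rnorm_ge0.
move=> x; have [dx xE] := RA x.
rewrite extrapolation_rnorm -{1}xE linearB linearZ /= TA//.
apply: le_trans (rnormB _ _) _; rewrite rnormZc mulrDl lerD ?S'C// -mulrA.
by rewrite ler_wpM2l ?rnorm_ge0.
Unshelve. all: by end_near. Qed.

(** The smoothing estimate says that [T a] is bounded for the weaker norm, so
it extends by density to a bounded map from the extrapolation space to [X]. *)
Lemma smoothing_lift (a C : R) : 0 <= a -> 0 < C ->
  (forall x, rnorm (T a x) <= C * rnorm (j x)) ->
  forall y, exists2 x, j x = Tm1 a y & rnorm x <= C * rnorm y.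
Proof.
move=> a0 C0 TC y; have [_ dj [Tc _ _ _] jT] := Xm1_extrapolation.
have /choice[z zP] : forall n : nat, exists x, rnorm (y - j x) < n.+1%:R^-1.
  by move=> n; exact: dense_rnorm.
have jz : j (z n) @[n --> \oo] --> y.
  apply/rnorm_cvgP; apply: squeeze_cvgr (cvg_cst 0) (@cvg_harmonic R).
  by apply: nearW => n; rewrite rnorm_ge0 rnorm_distC ltW// zP.
have [x zx] : exists x : X, T a (z n) @[n --> \oo] --> x.
  apply: rnorm_cauchy_cvg => e e0.
  have /rnorm_cvgP/cvgrPdist_lt/(_ (e / (2 * C))) := jz.
  rewrite divr_gt0 ?mulr_gt0// => /(_ isT)[N _ NP].
  exists N => n Nn; rewrite -linearB.
  apply: le_lt_trans (TC _) _.
  have := NP N (leqnn N); have := NP n Nn; rewrite /= !sub0r !normrN.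
  rewrite !ger0_norm ?rnorm_ge0// => h1 h2.
  have h3 := rnormB (j (z N) - y) (j (z n) - y).
  rewrite opprB addrA subrK -linearB in h3.
  rewrite -ltr_pdivlMl//; apply: le_lt_trans h3 _.
  have -> : C^-1 * e = e / (2 * C) + e / (2 * C).
    by field; rewrite gt_eqF.
  exact: ltrD.
exists x.
  apply: (@cvg_unique _ (@norm_hausdorff _ Xm1) ((fun n =>
    j (T a (z n))) @ \oo)).
    apply: continuous_cvg => //; exact: continuous_extrapolation.
  apply: (@eq_cvgn _ (fun n => Tm1 a (j (z n)))) => [n|]; first exact: jT.
  apply: continuous_cvg => //; exact: Tc.
have h1 : rnorm (T a (z n)) @[n --> \oo] --> rnorm x by exact: cvg_rnorm.
have h2 : C * rnorm (j (z n)) @[n --> \oo] --> C * rnorm y.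
  by apply: cvgMr; exact: cvg_rnorm.
by apply: ler_cvg_to h1 h2 _; apply: nearW => n; exact: TC.
Qed.

End Operators.

(** * The input map *)

Section SemigroupOrbit.
Import HBSimple HBNNSimple.
Context {R : realType} {V : completeNormedModType R[i]}.
Context (S : R -> {linear V -> V}) (S_C0 : C0_semigroup S).

Lemma C0_semigroup_right (v : V) (e : R) : 0 < e ->
  exists2 d : R, 0 < d & forall t, 0 <= t < d -> rnorm (S t v - v) < e.
Proof.
have [_ S0 _ Sv] := S_C0; move=> e0.
have /rnorm_cvgP/cvgrPdist_lt/(_ _ e0) := Sv v.
move=> [d /= d0 dP]; exists d => // t /andP[t0 td].
have [->|tn0] := eqVneq t 0; first by rewrite S0 subrr rnorm0.
have tp : 0 < t by rewrite lt_def tn0.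
have := dP t; rewrite /= sub0r normrN gtr0_norm// sub0r normrN.
by rewrite ger0_norm ?rnorm_ge0//; exact.
Qed.

(** Approximate [phi] from below by simple functions [psi n] with nonnegative
values: then [S (phi x) = S (psi n x) S (phi x - psi n x)], and continuity of
[S] at [0] from the right together with the uniform bound suffices. *)
Lemma strongly_measurable_semigroup (M : R) (D : set R) (phi : R -> R)
    (u : R -> V) :
  (forall t v, 0 <= t -> rnorm (S t v) <= M * rnorm v) ->
  measurable D -> measurable_fun D phi -> (forall x, D x -> 0 <= phi x) ->
  strongly_measurable D u -> strongly_measurable D (fun x => S (phi x) (u x)).
Proof.
move=> SM mD mphi phi0 [s fs sf]; have [_ S0 SD _] := S_C0.
have mE : measurable_fun D (EFin \o phi) by exact/measurable_EFinP.
pose psi n := nnsfun_approx mD mE n.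
have psic x : D x -> psi n x @[n --> \oo] --> phi x.
  move=> Dx; have phi0' y : D y -> (0 <= (EFin \o phi) y)%E.
    by move=> Dy; rewrite lee_fin phi0.
  by have /fine_cvgP[_] := cvg_nnsfun_approx mD mE phi0' Dx.
have psile n x : D x -> psi n x <= phi x.
  move=> Dx; rewrite -(cvg_lim _ (psic x Dx))//.
  apply: (nondecreasing_cvgn_le (u_ := fun n => psi n x)).
    by move=> a b ab; have /lefP := nd_nnsfun_approx mD mE ab; apply.
  by apply/cvg_ex; exists (phi x); exact: psic.
exists (fun n x => S (psi n x) (s n x)) => [n|x Dx].
  apply: (finitely_valued_comp (fun c =>
    S c.1 c.2) (finitely_valued_pair _ (fs n))).
  split; first exact: fimfunP.
  by move=> a; exact: measurable_sfunP.
have psi0 n : 0 <= psi n x by [].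
apply/rnorm_cvgP/cvgrPdist_lt => e e0.
have M0 : 0 <= `|M| by [].
have e0' : 0 < e / (2 * (`|M| + 1)).
  by rewrite divr_gt0// mulr_gt0// ltr_wpDl.
have [d d0 dP] := C0_semigroup_right (u x) e0'.
have /cvgrPdist_lt/(_ _ d0) := psic x Dx.
have /rnorm_cvgP/cvgrPdist_lt/(_ _ e0') := sf x Dx.
apply: filterS2 => n; rewrite !sub0r !normrN !(ger0_norm (rnorm_ge0 _)) => un.
have dn0 : 0 <= phi x - psi n x by rewrite subr_ge0 psile.
rewrite (ger0_norm dn0) => pn.
have SMa t v : 0 <= t -> rnorm (S t v) <= (`|M| + 1) * rnorm v.
  move=> t0; apply: le_trans (SM t v t0) _; rewrite ler_wpM2r ?rnorm_ge0//.
  by have := ler_norm M; lra.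
have -> : S (psi n x) (s n x) - S (phi x) (u x) =
    S (psi n x) (s n x - u x) - S (psi n x) (S (phi x - psi n x) (u x) - u x).
  rewrite !linearB /= -SD ?subr_ge0 ?psile// [psi n x + _]addrC subrK.
  by rewrite opprK (addrC (- S (phi x) _)) addrA subrK.
apply: le_lt_trans (rnormB _ _) _.
have h1 := SMa _ (s n x - u x) (psi0 n).
have h2 := SMa _ (S (phi x - psi n x) (u x) - u x) (psi0 n).
have h3 := dP (phi x - psi n x); rewrite subr_ge0 psile// pn in h3.
have {}h3 := h3 isT.
have M1 : 0 < `|M| + 1 by rewrite ltr_wpDl.
apply: le_lt_trans (lerD h1 h2) _; rewrite -mulrDr -ltr_pdivlMl//.
apply: lt_le_trans (ltrD un h3) _.
by rewrite le_eqVlt; apply/orP; left; apply/eqP; field; rewrite gt_eqF.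
Qed.

End SemigroupOrbit.

Section Phi.
Context {R : realType} {Xm1 U : completeNormedModType R[i]}.
Context (S : R -> {linear Xm1 -> Xm1}) (B : {linear U -> Xm1}) (M CB : R).
Context (S_C0 : C0_semigroup S) (B_bounded : continuous B).
Context (SM : forall t v, 0 <= t -> rnorm (S t v) <= M * rnorm v).
Context (M0 : 0 <= M) (CB0 : 0 <= CB).
Context (BC : forall v, rnorm (B v) <= CB * rnorm v).
Implicit Types (u w : R -> U) (t b : R).

Definition integrable_input t u : Prop :=
  strongly_measurable `[0, t]%classic u /\
  (\int[mu]_(s in `[0%R, t]%classic) (rnorm (u s))%:E < +oo)%E.

Let Phi := Phi S B.

Lemma itv_fin t b : (mu `[t, b]%classic < +oo)%E.
Proof. by rewrite lebesgue_measure_itv /=; case: ifP => // _;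
  rewrite -EFinB ltry. Qed.

Lemma strongly_measurable_convolution t u : strongly_measurable `[0,
    t]%classic u ->
  strongly_measurable `[0, t]%classic (fun s => S (t - s) (B (u s))).
Proof.
move=> smu; apply: (strongly_measurable_semigroup S_C0 SM) => //.
- by apply: measurable_funTS; exact: measurable_funB.
- by move=> s; rewrite /= in_itv /= subr_ge0 => /andP[].
- exact: (strongly_measurable_comp B_bounded smu).
Qed.

Lemma le_integral_convolution t u : strongly_measurable `[0, t]%classic u ->
  (\int[mu]_(s in `[0%R, t]%classic) (rnorm (S (t - s) (B (u s))))%:E <=
   (M * CB)%:E * \int[mu]_(s in `[0%R, t]%classic) (rnorm (u s))%:E)%E.
Proof.
move=> smu; have mu' := measurable_rnorm smu.
rewrite -integralZ_real//; [|by move=> *; exact: rnorm_ge0|exact: mulr_ge0].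
apply: le_integral_real => //.
- exact: measurable_rnorm (strongly_measurable_convolution smu).
- exact: measurable_funM.
- by move=> *; exact: rnorm_ge0.
move=> s /=; rewrite in_itv /= => /andP[_ st].
apply: le_trans (SM _ _) _; first by rewrite subr_ge0.
by rewrite -mulrA ler_wpM2l.
Qed.

Lemma is_bochner_integral_Phi t u : integrable_input t u ->
  is_bochner_integral `[0, t]%classic (fun s => S (t - s) (B (u s))) (Phi t u).
Proof.
move=> [smu uoo].
have [v vP] : exists v, is_bochner_integral `[0, t]%classic (fun s =>
  S (t - s) (B (u s))) v.
  apply: bochner_integral_exists => //; first exact: itv_fin.
    exact: strongly_measurable_convolution.
  apply: le_lt_trans (le_integral_convolution smu) _.
  by rewrite lte_mul_pinfty ?lee_fin// mulr_ge0.
rewrite /Phi /Defs.Phi (bochner_integral_eq _ _ vP)//; exact: itv_fin.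
Qed.

Lemma le_Phi t u : integrable_input t u ->
  ((rnorm (Phi t u))%:E <=
   (M * CB)%:E * \int[mu]_(s in `[0%R, t]%classic) (rnorm (u s))%:E)%E.
Proof.
move=> iu; apply: le_trans (le_integral_convolution iu.1).
by apply: le_bochner_integral (is_bochner_integral_Phi iu) => //;
  exact: itv_fin.
Qed.

Lemma eq_Phi t u w : (forall s, 0 <= s <= t -> u s = w s) -> Phi t u = Phi t w.
Proof.
move=> uw; rewrite /Phi /Defs.Phi /bochner_integral; congr xget.
by apply/seteqP; split=> v; apply: eq_bochner_integral => s;
  rewrite /= in_itv /= => /uw ->.
Qed.

Lemma integrable_input_shift t b u : 0 <= b -> 0 <= t ->
  integrable_input (t + b) u -> integrable_input t (fun s => u (s + b)).
Proof.
move=> b0 t0 [smu uoo].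
have sub : `[b, t + b]%classic `<=` `[0, t + b]%classic.
  by move=> s; rewrite /= !in_itv /= => /andP[bs ->]; rewrite (le_trans b0 bs).
have E : `[0, t]%classic = [set s | `[b, t + b]%classic (s + b)].
  by apply/seteqP; split=> s; rewrite /= !in_itv /= lerD2r lerDr.
have smb := sub_strongly_measurable sub smu.
split; rewrite E; first exact: strongly_measurable_shift smb.
rewrite (@ge0_integral_shift _ b `[b, t + b]%classic (fun s => rnorm (u s)))//.
- apply: le_lt_trans uoo; apply: sub_integral_real => //.
    exact: measurable_rnorm.
  by move=> *; exact: rnorm_ge0.
- exact: measurable_rnorm.
- by move=> *; exact: rnorm_ge0.
Qed.

Lemma sub_integrable_input t b u : b <= t ->
  integrable_input t u -> integrable_input b u.
Proof.
move=> bt [smu uoo].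
have sub : `[0, b]%classic `<=` `[0, t]%classic.
  by move=> s; rewrite /= !in_itv /= => /andP[-> /le_trans]; exact.
split; first exact: sub_strongly_measurable sub smu.
apply: le_lt_trans uoo; apply: sub_integral_real => //.
  exact: measurable_rnorm.
by move=> *; exact: rnorm_ge0.
Qed.

(** On the past of [b] the kernel [S (t + b - s)] factors through [S t], and a
translation by [b] turns the rest into an input map over [[0, t]]. *)
Lemma Phi_split t b u : 0 <= b -> 0 <= t -> integrable_input (t + b) u ->
  Phi (t + b) u = S t (Phi b u) + Phi t (fun s => u (s + b)).
Proof.
move=> b0 t0 iu; have [Sc _ SD _] := S_C0.
have ib : integrable_input b u by apply: sub_integrable_input iu; rewrite lerDr.
have is' := integrable_input_shift b0 t0 iu.
have h1 : is_bochner_integral `[0, b]%classic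
    (fun s => S (t + b - s) (B (u s))) (S t (Phi b u)).
  apply: eq_bochner_integral (is_bochner_integral_linear (Sc t t0)
    _ _ (is_bochner_integral_Phi ib)) => //.
  - move=> s; rewrite /= in_itv /= => /andP[_ sb].
    by rewrite -SD ?subr_ge0// addrA.
  - exact: itv_fin.
have h2 : is_bochner_integral `[b, t + b]%classic
    (fun s => S (t + b - s) (B (u s))) (Phi t (fun s => u (s + b))).
  have := is_bochner_integral_shift (- b) (measurable_itv _)
    (is_bochner_integral_Phi is').
  have -> : [set x | `[0, t]%classic (x - b)] = `[b, t + b]%classic.
    by apply/seteqP; split=> s; rewrite /= !in_itv /= subr_ge0 lerBlDr.
  apply: eq_bochner_integral => s _.
  by rewrite subrK opprB addrA.
have {}h2 : is_bochner_integral `]b, t + b]%classic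
    (fun s => S (t + b - s) (B (u s))) (Phi t (fun s => u (s + b))).
  apply: is_bochner_integral_ae h2 => //; first exact: itv_fin.
  - by move=> s; rewrite /= !in_itv /= => /andP[/ltW -> ->].
  - have -> : `[b, t + b]%classic `\` `]b, t + b]%classic = [set b].
      apply/seteqP; split=> s; rewrite /= !in_itv /=.
        move=> [/andP[bs st]]; rewrite st andbT => /negP; rewrite -leNgt => sb.
        by apply/eqP; rewrite eq_le sb bs.
      by move=> ->; rewrite lexx ltxx lerDr t0.
    exact: lebesgue_measure_set1.
have := is_bochner_integralU _ _ _ _ _ h1 h2.
have -> : `[0, b]%classic `|` `]b, t + b]%classic = `[0, t + b]%classic.
  apply/seteqP; split=> s; rewrite /= !in_itv /=.
    move=> [/andP[-> /= sb]|/andP[/ltW bs ->]];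
      first by rewrite (le_trans sb)// lerDr.
    by rewrite (le_trans b0 bs).
  by move=> /andP[s0 st]; case: (leP s b) => sb; [left; rewrite s0|right].
move=> h; rewrite {1}/Phi /Defs.Phi; apply: bochner_integral_eq => //.
  exact: itv_fin.
apply: h => //.
- exact: itv_fin.
- by apply: le_lt_trans (itv_fin b (t + b)); apply: le_mu => // s;
    rewrite /= !in_itv /= => /andP[/ltW -> ->].
- apply/seteqP; split=> s //=; rewrite !in_itv /= => -[/andP[_ sb] /andP[bs _]].
  by move: (lt_le_trans bs sb); rewrite ltxx.
Qed.

Lemma PhiZ t (c : R) u : integrable_input t u ->
  Phi t (fun s => c%:C *: u s) = c%:C *: Phi t u.
Proof.
move=> iu; rewrite {1}/Phi /Defs.Phi; apply: bochner_integral_eq => //.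
  exact: itv_fin.
pose L : {linear Xm1 -> Xm1} := ( *:%R c%:C ).
have cL : continuous L by move=> y; exact: scaler_continuous.
have := is_bochner_integral_linear cL (measurable_itv _) (itv_fin _ _)
  (is_bochner_integral_Phi iu).
by apply: eq_bochner_integral => s _; rewrite /= !linearZ.
Qed.

End Phi.

(** * Time blocks and extension of inputs by zero *)

Section TimeBlocks.
Context {R : realType}.
Implicit Types (a s : R) (k : nat).

(** [Num.truncn] vanishes on negative numbers, so the block [0] also contains
all negative times; this can only enlarge the norm of an input over that block. *)
Definition time_block a s : nat := Num.truncn (s / a).

Lemma time_block_lt a s : 0 < a -> s < (time_block a s).+1%:R * a.
Proof. by move=> a0; rewrite -ltr_pdivrMr// -truncn_le_nat. Qed.

Lemma time_block_ge a s : 0 < a -> 0 <= s -> (time_block a s)%:R * a <= s.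
Proof.
move=> a0 s0; rewrite -ler_pdivlMr//.
by have /andP[] := truncn_itv (divr_ge0 s0 (ltW a0)).
Qed.

Lemma le_time_block a s s' : 0 < a -> s <= s' ->
    (time_block a s <= time_block a s')%N.
Proof. by move=> a0 ss; apply: le_truncn; rewrite ler_pM2r ?invr_gt0. Qed.

Lemma time_block_eqS a s k : 0 < a ->
  (time_block a s = k.+1) <-> (k.+1%:R * a <= s < k.+2%:R * a).
Proof.
move=> a0; rewrite /time_block -ler_pdivlMr// -ltr_pdivrMr// -truncn_le_nat
  -truncn_gt_nat.
by rewrite andbC -eqn_leq; split=> [->|/eqP].
Qed.

Lemma time_block_eq0 a s : 0 < a -> (time_block a s = 0%N) <-> s < a.
Proof.
move=> a0; have -> : (s < a) = (s / a < 1%:R) by rewrite ltr_pdivrMr// mul1r.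
rewrite /time_block -truncn_le_nat leqn0.
by split=> [->|/eqP].
Qed.

Lemma measurable_time_block a k : 0 < a ->
    measurable [set s | time_block a s = k].
Proof.
move=> a0; case: k => [|k].
  have -> : [set s | time_block a s = 0%N] = `]-oo, a[%classic.
    by apply/seteqP; split=> s /=; rewrite in_itv /= => /time_block_eq0; exact.
  exact: measurable_itv.
have -> : [set s | time_block a s = k.+1] = `[k.+1%:R * a, k.+2%:R * a[%classic.
  by apply/seteqP; split=> s /=; rewrite in_itv /= => /time_block_eqS; exact.
exact: measurable_itv.
Qed.

End TimeBlocks.

Section GlobalInputs.
Context {R : realType} {V : completeNormedModType R[i]}.
Implicit Types (p : \bar R) (t : R) (u : R -> V).

Local Notation N p h := (Lnorm mu p (EFin \o h)).

Lemma measurable_rnormT u : strongly_measurable setT u ->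
  measurable_fun setT (fun s => rnorm (u s)).
Proof. exact: measurable_rnorm. Qed.

Lemma measurable_Lp_integrand (D : set R) u : measurable D ->
  strongly_measurable D u -> measurable_fun setT (fun s =>
    \1_D s * rnorm (u s)).
Proof.
move=> mD /measurable_rnorm mu'.
have -> : (fun s => \1_D s * rnorm (u s)) = (fun s => rnorm (u s)) \_ D.
  by rewrite patch_indic; apply/funext => s /=; rewrite mulrC.
exact: (measurable_restrictT (fun s => rnorm (u s)) mD).1 mu'.
Qed.

(** Inputs are extended by zero so that the input map can be evaluated at all
times and the norm of the input is a norm over the whole line. *)
Definition zero_extension t u : R -> V :=
  fun s => if `[< `[0, t]%classic s >] then u s else 0.

Lemma strongly_measurable_zero_extension t u :
  strongly_measurable `[0, t]%classic u ->
  strongly_measurable setT (zero_extension t u).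
Proof.
move=> smu; apply: strongly_measurable_if => //; first by rewrite setTI.
exact: strongly_measurable_cst.
Qed.

Lemma Lnorm_zero_extension p t u :
  N p (fun s => rnorm (zero_extension t u s)) = Lp_norm p t u.
Proof.
apply: eq_Lnorm => s /=; congr EFin; rewrite /zero_extension indicE.
case: asboolP => ts; first by rewrite mem_set// mul1r.
by rewrite memNset// mul0r rnorm0.
Qed.

Lemma integrable_input_global p u t (C : R) : (1 <= p)%E ->
  strongly_measurable setT u -> (N p (fun s => rnorm (u s)) <= C%:E)%E ->
  integrable_input t u.
Proof.
move=> p1 smu NC.
split; first by apply: sub_strongly_measurable smu.
apply: le_lt_trans (integral_le_Lnorm p1 _ (itv_fin _ _)
  (measurable_rnormT smu) _) _ => //.
  by move=> *; exact: rnorm_ge0.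
have mE : mu `[0, t]%classic = (fine (mu `[0, t]%classic))%:E.
  by rewrite fineK// ge0_fin_numE// itv_fin.
apply: (@le_lt_trans _ _ ((1 + mu `[0%R, t]%classic) * C%:E)%E).
  by apply: lee_wpmul2l => //; rewrite adde_ge0.
by rewrite mE -EFinD -EFinM ltry.
Qed.

Lemma integrable_input_Lp p u t : (1 <= p)%E -> in_Lp p t u ->
    integrable_input t u.
Proof.
move=> p1 [smu uoo]; have smz := strongly_measurable_zero_extension smu.
have NC : (N p (fun s => rnorm (zero_extension t u s)) <=
  (fine (Lp_norm p t u))%:E)%E.
  by rewrite Lnorm_zero_extension fineK// ge0_fin_numE ?Lnorm_ge0.
have [_ zoo] := integrable_input_global t p1 smz NC.
split=> //; move: zoo; congr (_ < _)%E; apply: eq_integral => s;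
  rewrite inE => ts.
by rewrite /zero_extension asboolT.
Qed.

End GlobalInputs.

(** * State and windows of an input over the blocks *)

Section GeometricSums.
Context {R : realType}.
Implicit Types (rho : R) (a : nat -> R) (k : nat).

Fixpoint geometric_sum rho a k : R :=
  if k is k'.+1 then rho * geometric_sum rho a k' + a k else a 0%N.

(** The sum of two consecutive geometric sums.  An interval of length [a] that
is closed at both ends meets two blocks, so that the norm of the input on it is
bounded by [a k + a k.+1] and not by [a k]; this variant absorbs such terms
([geometric_sum2S]) and is comparable to the original sum
([geometric_sum2_le]). *)
Definition geometric_sum2 rho a k : R :=
  geometric_sum rho a k + (if k is k'.+1 then geometric_sum rho a k' else 0).

Lemma geometric_sum_ge0 rho a k : 0 <= rho -> (forall k, 0 <= a k) ->
  0 <= geometric_sum rho a k.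
Proof. by move=> r0 a0; elim: k => //= k IH; rewrite addr_ge0// mulr_ge0. Qed.

Lemma geometric_sum_ge rho a k : 0 <= rho -> (forall k, 0 <= a k) ->
  a k <= geometric_sum rho a k.
Proof.
by move=> r0 a0; case: k => //= k; rewrite lerDr mulr_ge0// geometric_sum_ge0.
Qed.

Lemma geometric_sum2S rho a k : geometric_sum2 rho a k.+1 =
  rho * geometric_sum2 rho a k + (a k + a k.+1).
Proof. by case: k => [|k]; rewrite /geometric_sum2 /=; ring. Qed.

Lemma geometric_sum2_ge0 rho a k : 0 <= rho -> (forall k, 0 <= a k) ->
  0 <= geometric_sum2 rho a k.
Proof.
by move=> r0 a0; rewrite /geometric_sum2 addr_ge0//; case: k => *;
  rewrite ?geometric_sum_ge0.
Qed.

Lemma geometric_sum2_le rho a k : 0 < rho -> (forall k, 0 <= a k) ->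
  geometric_sum2 rho a k <= (1 + rho^-1) * geometric_sum rho a k.
Proof.
move=> r0 a0; rewrite /geometric_sum2 mulrDl mul1r lerD2l.
case: k => [|k] /=; first by rewrite mulr_ge0// invr_ge0 ltW.
by rewrite mulrDr mulKf ?gt_eqF// lerDl mulr_ge0// invr_ge0 ltW.
Qed.

Lemma geometric_sum_leS rho a k : 0 < rho -> (forall k, 0 <= a k) ->
  geometric_sum rho a k <= rho^-1 * geometric_sum rho a k.+1.
Proof.
move=> r0 a0 /=; rewrite mulrDr mulKf ?gt_eqF// lerDl mulr_ge0// invr_ge0 ltW//.
Qed.

End GeometricSums.

Section Windows.
Context {R : realType} {Xm1 U : completeNormedModType R[i]}.
Context (S : R -> {linear Xm1 -> Xm1}) (B : {linear U -> Xm1}).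
Context (M omega CB : R).
Context (S_C0 : C0_semigroup S) (B_bounded : continuous B).
Context (M0 : 0 < M) (omega0 : 0 < omega) (CB0 : 0 <= CB).
Context (SMe : forall t y, 0 <= t -> rnorm (S t y) <=
  M * expR (- omega * t) * rnorm y).
Context (BC : forall v, rnorm (B v) <= CB * rnorm v).
Context (a : R) (a0 : 0 < a) (p : \bar R) (p1 : (1 <= p)%E).
Context (u : R -> U) (C : R) (smu : strongly_measurable setT u).

Local Notation N h := (Lnorm mu p (EFin \o h)).
Context (NC : (N (fun s => rnorm (u s)) <= C%:E)%E).

Let v s := rnorm (u s).
Let Kv k s := \1_[set r | time_block a r = k] s * v s.
Let rho := expR (- omega * a).

Definition block_norm (k : nat) : R := fine (N (Kv k)).
Let al := block_norm.

Lemma exp_stable_bounded t y : 0 <= t -> rnorm (S t y) <= M * rnorm y.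
Proof.
move=> t0; apply: le_trans (SMe y t0) _.
rewrite ler_wpM2r ?rnorm_ge0// ler_piMr ?(ltW M0)// -expR0 ler_expR.
by rewrite mulNr oppr_le0 mulr_ge0// ltW.
Qed.

Let mv : measurable_fun setT v. Proof. exact: measurable_rnormT. Qed.
Let v0 s : 0 <= v s. Proof. exact: rnorm_ge0. Qed.
Let mKv k : measurable_fun setT (Kv k).
Proof. by apply: measurable_restrict_indic => //;
  exact: measurable_time_block. Qed.
Let Kv0 k s : 0 <= Kv k s. Proof. exact: indic_mul_ge0. Qed.

Lemma block_norm_ge0 k : 0 <= al k.
Proof. by apply: fine_ge0; exact: Lnorm_ge0. Qed.

Lemma block_normE k : N (Kv k) = (al k)%:E.
Proof.
rewrite fineK// ge0_fin_numE ?Lnorm_ge0//; apply: le_lt_trans (ltry C).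
apply: le_trans NC; apply: (le_Lnorm p1 (mKv k) mv (Kv0 k) v0).
apply: ae_all => s; rewrite /Kv ler_piMl// indicE; case: (_ \in _) => //.
Qed.

Let iu t : integrable_input t u.
Proof. exact: integrable_input_global p1 smu NC. Qed.

Let KvE k s : time_block a s = k -> Kv k s = v s.
Proof. by move=> sk; rewrite /Kv indicE mem_set// mul1r. Qed.

Lemma two_blocks_norm k (b : R) :
  (N (fun s => (Kv k (s + b) + Kv k.+1 (s + b))%R) <= (al k + al k.+1)%:E)%E.
Proof.
rewrite EFinD -!block_normE.
have m2 : measurable_fun setT (fun s =>
  Kv k s + Kv k.+1 s) by exact: measurable_funD.
apply: le_trans (Lnorm_shift_le b p1 m2 _) _; first by move=> s;
  rewrite addr_ge0.
exact: LnormD_le.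
Qed.

Lemma two_blocks_ge k s : k%:R * a <= s < k.+2%:R * a ->
    v s <= Kv k s + Kv k.+1 s.
Proof.
move=> /andP[ks sk]; have s0 : 0 <= s.
  by apply: le_trans ks; rewrite mulr_ge0// ltW.
have [sk1|ks1] := ltP s (k.+1%:R * a); last first.
  by rewrite (@KvE k.+1) ?lerDr//; apply/time_block_eqS => //; rewrite ks1.
rewrite (@KvE k) ?lerDl//; move: ks sk1 {sk}; case: k => [|k] ks sk1.
  by apply/time_block_eq0 => //; rewrite mul1r in sk1.
by apply/time_block_eqS => //; rewrite ks.
Qed.

Lemma Phi0_eq0 : Phi S B 0 u = 0.
Proof.
apply/eqP; rewrite -rnorm_eq0 eq_le rnorm_ge0 andbT -lee_fin.
apply: le_trans (le_Phi S_C0 B_bounded exp_stable_bounded (ltW M0)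
  CB0 BC (iu 0)) _.
by rewrite set_itv1 integral_set1 mule0.
Qed.

Let Q := M * (M * CB * (1 + a)).

(** The factor [expR (- omega * t)] is part of the induction: with [t = a] it
becomes the ratio of the geometric sum.  Estimating [Phi (m * a) u] first and
using [M * expR (- omega * a)] as a ratio would fail, as this may exceed [1]. *)
Lemma state_bound m t : 0 <= t ->
  rnorm (S t (Phi S B (m%:R * a) u)) <=
  expR (- omega * t) * (Q * geometric_sum2 rho al m).
Proof.
have ma0 k : 0 <= k%:R * a by rewrite mulr_ge0// ltW.
have Q0 : 0 <= Q by rewrite !mulr_ge0 ?(ltW M0)// addr_ge0 ?(ltW a0).
elim: m t => [|m IH] t t0.
  rewrite mul0r Phi0_eq0 linear0 rnorm0 mulr_ge0 ?expR_ge0// mulr_ge0//.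
  by rewrite geometric_sum2_ge0 ?expR_ge0//; exact: block_norm_ge0.
have [_ _ SD _] := S_C0.
have -> : m.+1%:R * a = a + m%:R * a by rewrite -natr1 mulrDl mul1r addrC.
rewrite (Phi_split S_C0 B_bounded exp_stable_bounded (ltW M0) CB0 BC (ma0 m)
  (ltW a0) (iu _)).
rewrite linearD /= -SD ?(ltW a0)//.
apply: le_trans (rnormD _ _) _.
rewrite geometric_sum2S mulrDr mulrDr; apply: lerD.
  apply: le_trans (IH _ _) _; first by rewrite addr_ge0 ?(ltW a0).
  by rewrite mulrDr expRD -mulrA ler_wpM2l ?expR_ge0// mulrCA.
apply: le_trans (SMe _ t0) _; rewrite mulrAC mulrC ler_wpM2l ?expR_ge0//.
rewrite /Q -mulrA ler_wpM2l ?(ltW M0)//.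
have isft := integrable_input_shift (ma0 m) (ltW a0) (iu (a + m%:R * a)).
rewrite -lee_fin.
apply: le_trans (le_Phi S_C0 B_bounded exp_stable_bounded (ltW M0) CB0 BC isft)
  _.
rewrite -(mulrA (M * CB)) [in leRHS]EFinM; apply: lee_wpmul2l;
  first by rewrite lee_fin mulr_ge0 ?(ltW M0).
pose h s := Kv m (s + m%:R * a) + Kv m.+1 (s + m%:R * a).
have mh : measurable_fun setT h.
  have ms : measurable_fun setT (fun s : R =>
    s + m%:R * a) by exact: measurable_funD.
  by apply: measurable_funD; [exact: (measurableT_comp (mKv m)
    ms)|exact: (measurableT_comp (mKv m.+1) ms)].
have h0 s : 0 <= h s by rewrite addr_ge0.
apply: (@le_trans _ _ (\int[mu]_(s in `[0%R, a]%classic) (h s)%:E)%E).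
  apply: le_integral_real => //.
  - exact: measurable_rnorm isft.1.
  - exact: measurable_funTS.
  - by move=> *; exact: rnorm_ge0.
  move=> s /=; rewrite in_itv /= => /andP[s0 sa].
  apply: two_blocks_ge; rewrite lerDr s0 /=.
  have -> : m.+2%:R * a = a + a + m%:R * a by rewrite -addn2 natrD; ring.
  by rewrite ltrD2r; apply: le_lt_trans sa _; rewrite ltrDl.
apply: le_trans (integral_le_Lnorm p1 _ (itv_fin _ _) mh h0) _ => //.
have -> : mu `[0, a]%classic = a%:E.
  by rewrite lebesgue_measure_itv /= lte_fin a0 sube0.
rewrite -EFinD EFinM; apply: lee_wpmul2l;
  first by rewrite lee_fin addr_ge0 ?(ltW a0).
exact: two_blocks_norm.
Qed.

(** The input seen by the block [k] starts one block earlier; it is cut at the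
end of the block [k] so that, by causality, only the blocks [k.-1] and [k]
enter its norm. *)
Definition window (k : nat) : R -> U :=
  fun s => if `[< s + k.-1%:R * a < k.+1%:R * a >] then u (s + k.-1%:R * a)
    else 0.

Lemma in_Lp_window k : in_Lp p (2 * a) (window k) /\
  (Lp_norm p (2 * a) (window k) <= (geometric_sum2 rho al k)%:E)%E.
Proof.
have rho0 : 0 <= rho by exact: expR_ge0.
have smw : strongly_measurable `[0, (2 * a)]%classic (window k).
  have mE : measurable [set s : R | s + k.-1%:R * a < k.+1%:R * a].
    have -> : [set s | s + k.-1%:R * a < k.+1%:R * a] =
        `]-oo, (k.+1%:R * a - k.-1%:R * a)[%classic.
      by apply/seteqP; split=> s /=; rewrite in_itv /= ltrBrDr.
    exact: measurable_itv.
  apply: (strongly_measurable_if mE); last exact: strongly_measurable_cst.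
  have := strongly_measurable_shift (k.-1%:R * a) smu.
  by apply: sub_strongly_measurable.
suff H : (Lp_norm p (2 * a) (window k) <= (geometric_sum2 rho al k)%:E)%E.
  by split=> //; split=> //; apply: le_lt_trans H (ltry _).
have mw : measurable_fun setT (fun s =>
  \1_(`[0, (2 * a)]%classic) s * rnorm (window k s)).
  exact: measurable_Lp_integrand.
have w0 s : 0 <= \1_(`[0, (2 * a)]%classic) s * rnorm (window k s).
  by rewrite mulr_ge0 ?rnorm_ge0// indicE.
have rho00 := expR_ge0 (- omega * a).
have sh (k' : nat) (b : R) : measurable_fun setT (fun s : R => Kv k' (s + b)).
  have ms : measurable_fun setT (fun s : R => s + b) by exact: measurable_funD.
  exact: (measurableT_comp (mKv k') ms).
have wE s : \1_(`[0, (2 * a)]%classic) s * rnorm (window k s) =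
    if (0 <= s <= 2 * a) && (s + k.-1%:R * a < k.+1%:R * a)
    then v (s + k.-1%:R * a) else 0.
  rewrite indicE /window; have [s2|s2] := boolP (0 <= s <= 2 * a).
    rewrite mem_set /= ?in_itv// mul1r; case: asboolP => [->//|/negP].
    by rewrite -leNgt => h; rewrite ltNge h rnorm0.
  by rewrite memNset ?mul0r//= in_itv; exact/negP.
case: k smw mw w0 wE => [|k] smw mw w0 wE.
  rewrite /geometric_sum2 /= addr0 -block_normE.
  apply: (@le_trans _ _ (N (fun s => Kv 0%N (s + 0))));
    last exact: Lnorm_shift_le.
  apply: le_Lnorm => //.
  apply: ae_all => s; rewrite wE; case: ifP => // /andP[/andP[s0 _]].
  rewrite /= !mul0r !addr0 mul1r => sa; rewrite KvE//.
  exact/time_block_eq0.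
apply: (@le_trans _ _ (al k + al k.+1)%:E); last first.
  rewrite lee_fin /geometric_sum2 addrC lerD//.
    by apply: geometric_sum_ge => //; exact: block_norm_ge0.
  by apply: geometric_sum_ge => //; exact: block_norm_ge0.
apply: le_trans (two_blocks_norm k (k%:R * a)).
apply: le_Lnorm => //.
- exact: measurable_funD.
- by move=> s; rewrite addr_ge0.
apply: ae_all => s; rewrite wE; case: ifP => [/andP[/andP[s0 _]] /= sk|_];
  last by rewrite addr_ge0.
by apply: two_blocks_ge; rewrite lerDr s0.
Qed.

End Windows.

(** * From a window to infinite time *)

Section Propagation.
Context {R : realType} {X Xm1 U : completeNormedModType R[i]}.
Context (T : R -> {linear X -> X}) (S : R -> {linear Xm1 -> Xm1}).
Context (j : {linear X -> Xm1}) (B : {linear U -> Xm1}).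
Context (M omega CB : R).
Context (T_C0 : C0_semigroup T) (S_C0 : C0_semigroup S)
  (B_bounded : continuous B).
Context (M0 : 0 < M) (omega0 : 0 < omega) (CB0 : 0 <= CB).
Context (TM : forall t x, 0 <= t -> rnorm (T t x) <= M * rnorm x).
Context (SMe : forall t y, 0 <= t -> rnorm (S t y) <=
  M * expR (- omega * t) * rnorm y).
Context (ST : forall t x, 0 <= t -> S t (j x) = j (T t x)).
Context (BC : forall v, rnorm (B v) <= CB * rnorm v).
Context (p : \bar R) (p1 : (1 <= p)%E).

Local Notation N h := (Lnorm mu p (EFin \o h)).

(** On the block [k] the output is [g k], the response to the window [k],
plus the orbit of [x k.-1], the smoothed state at the beginning of the window.
For [k = 0] there is no past and the second term is omitted. *)
Lemma infinite_time_of_window (a c C1 : R) : 0 < a -> 0 <= c -> 0 <= C1 ->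
  (forall y, exists2 x, j x = S a y & rnorm x <= C1 * rnorm y) ->
  (forall w, in_Lp p (2 * a) w -> exists2 g, Phi_eq_in_Lq j S B p (2 * a) w g &
     (Lp_norm p (2 * a) g <= c%:E * Lp_norm p (2 * a) w)%E) ->
  exists c', forall t u, 0 <= t -> in_Lp p t u ->
    exists2 f, Phi_eq_in_Lq j S B p t u f &
      (Lp_norm p t f <= c'%:E * Lp_norm p t u)%E.
Proof.
move=> a0 c0 C10 lift win.
pose rho := expR (- omega * a); pose Q := M * (M * CB * (1 + a)).
have rho0 : 0 < rho by exact: expR_gt0.
have rho1 : rho < 1 by rewrite /rho mulNr -expR0 ltr_expR oppr_lt0 mulr_gt0.
have Q0 : 0 <= Q by rewrite !mulr_ge0 ?(ltW M0)// addr_ge0 ?(ltW a0).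
have ri0 : 0 <= 1 + rho^-1 by rewrite addr_ge0// invr_ge0 ltW.
(* [c] bounds the responses to the windows; the second summand bounds the
   orbits, [M] coming from [T], [C1] from the smoothing, [Q] from the state, and
   [1 + a] from the length of a block *)
pose c2 := c * (1 + rho^-1) + M * (C1 * (Q * ((1 + rho^-1) * rho^-1)))
  * (1 + a).
have c20 : 0 <= c2.
  have h : 0 <= (1 + rho^-1) * rho^-1 by rewrite mulr_ge0// invr_ge0 ltW.
  have a1 : 0 <= 1 + a by rewrite addr_ge0 ?(ltW a0).
  by apply: addr_ge0; rewrite mulr_ge0// mulr_ge0 ?(ltW M0)// mulr_ge0//
    mulr_ge0.
exists (c2 / (1 - rho)) => t u t0 [smu uoo].
pose z := zero_extension t u.
have smz : strongly_measurable setT z by exact: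
  strongly_measurable_zero_extension.
pose Cn := fine (Lp_norm p t u).
have Cn0 : 0 <= Cn by apply: fine_ge0; exact: Lnorm_ge0.
have CnE : Lp_norm p t u = Cn%:E by rewrite fineK// ge0_fin_numE// Lnorm_ge0.
have NC : (N (fun s => rnorm (z s)) <= Cn%:E)%E.
  by rewrite Lnorm_zero_extension CnE.
pose al := block_norm a p z.
have al0 k : 0 <= al k by exact: block_norm_ge0.
pose b := geometric_sum rho al; pose B2 := geometric_sum2 rho al.
have b0 k : 0 <= b k by apply: geometric_sum_ge0 => //; exact: ltW.
have iz r : integrable_input r z by exact: integrable_input_global p1 smz NC.
have inw k := in_Lp_window omega a0 p1 smz NC k.
have /choice[g gP] : forall k, exists g,
  Phi_eq_in_Lq j S B p (2 * a) (window a z k) g /\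
    (Lp_norm p (2 * a) g <= (c * B2 k)%:E)%E.
  move=> k; have [iw wB] := inw k; have [g g1 g2] := win _ iw.
  exists g; split=> //; apply: le_trans g2 _.
  by rewrite EFinM; apply: lee_wpmul2l.
have /choice[x xP] : forall k : nat, exists x,
  j x = S a (Phi S B (k%:R * a) z) /\
    rnorm x <= C1 * (Q * B2 k).
  move=> k; have [x x1 x2] := lift (Phi S B (k%:R * a) z).
  exists x; split=> //; apply: le_trans x2 _; rewrite ler_wpM2l//.
  have := state_bound S_C0 B_bounded M0 omega0 CB0 SMe BC a0 p1 smz NC k (lexx
    0).
  by have [_ -> _ _] := S_C0; rewrite mulr0 expR0 mul1r.
pose K := time_block a.
have mK k : measurable [set s | K s = k] by exact: measurable_time_block.
pose fk k s := g k (s - k.-1%:R * a) +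
  (if k is k'.+1 then T (s - k%:R * a) (x k') else 0).
pose f s := fk (K s) s.
have Kwin k s : 0 <= s -> K s = k -> 0 <= s - k.-1%:R * a <= 2 * a.
  move=> s0 <-; have h1 := time_block_ge a0 s0; have := time_block_lt s a0.
  rewrite -/(K s) in h1 *; case: (K s) h1 => [|n] /= h1 h2.
    by rewrite mul0r subr0 s0 /=; lra.
  rewrite subr_ge0 lerBlDr -mulrDl -natrD add2n (ltW h2) andbT.
  by apply: le_trans h1; rewrite ler_pM2r// ler_nat.
have KT k s : 0 <= s -> K s = k -> 0 <= s - k%:R * a <= a.
  move=> s0 <-; have h1 := time_block_ge a0 s0; have := time_block_lt s a0.
  rewrite -/(K s) in h1 * => h2; rewrite subr_ge0 h1 /= lerBlDr.
  by apply: le_trans (ltW h2) _; rewrite -natr1 mulrDl mul1r addrC.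
have m0t := measurable_itv `[0, t].
have m02a := measurable_itv `[0, (2 * a)].
(* [fk k] is measurable on the block [k] only: elsewhere [T] would be taken at
   negative times *)
have smfk k : strongly_measurable (`[0,
  t]%classic `&` [set s | K s = k]) (fk k).
  apply: strongly_measurableD.
    have [[[smg _] _] _] := gP k.
    have := strongly_measurable_shift (- (k.-1%:R * a)) smg.
    apply: sub_strongly_measurable => s [] /=;
      rewrite !in_itv /= => /andP[s0 _].
    exact: Kwin.
  case: k => [|k]; first exact: strongly_measurable_cst.
  apply: (strongly_measurable_semigroup T_C0 TM) => //.
  - exact: measurableI.
  - by apply: measurable_funTS; apply: measurable_funB.
  - by move=> s [] /=; rewrite in_itv /= => /andP[s0 _] /(KT _ _ s0) /andP[].
  - exact: strongly_measurable_cst.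
have smf : strongly_measurable `[0, t]%classic f.
  apply: (strongly_measurable_glue mK) => k.
  by apply: eq_strongly_measurable (smfk k) => s [_ /= Ks]; rewrite /f Ks.
pose h s := \1_(`[0, t]%classic) s * rnorm (f s).
have mh : measurable_fun setT h by exact: measurable_Lp_integrand.
have h0 s : 0 <= h s by rewrite mulr_ge0 ?rnorm_ge0// indicE.
have hN k : (N (fun s => (\1_[set y | K y = k] s * h s)%R) <= (c2 * b k)%:E)%E.
  pose G r := \1_(`[0, (2 * a)]%classic) r * rnorm (g k r).
  have [[[smg _] _] gB] := gP k.
  have mG : measurable_fun setT G by exact: measurable_Lp_integrand.
  have G0 r : 0 <= G r by rewrite mulr_ge0 ?rnorm_ge0// indicE.
  pose kap := if k is k'.+1 then M * rnorm (x k') else 0.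
  have kap0 : 0 <= kap by rewrite /kap; case: (k) => // *;
    rewrite mulr_ge0 ?rnorm_ge0 ?(ltW M0).
  pose J := `[k%:R * a, k.+1%:R * a]%classic.
  have mJ : measurable J by exact: measurable_itv.
  have muJ : fine (mu J) = a.
    rewrite lebesgue_measure_itv /= lte_fin ltr_pM2r// ltr_nat ltnSn -EFinB /=.
    by rewrite -natr1; ring.
  have J0 s : 0 <= kap * \1_J s by rewrite mulr_ge0// indicE.
  have ms : measurable_fun setT (fun s : R =>
    s - k.-1%:R * a) by exact: measurable_funB.
  have mGs : measurable_fun setT (fun s : R =>
    G (s - k.-1%:R * a)) by exact: (measurableT_comp mG ms).
  have mI : measurable_fun setT (\1_J : R -> R) by exact: measurable_indic.
  have mJs : measurable_fun setT (fun s : R =>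
    kap * \1_J s) by exact: measurable_funM.
  have mKh : measurable_fun setT (fun s : R => \1_[set y | K y = k] s * h s).
    exact: measurable_restrict_indic.
  apply: (@le_trans _ _ (N (fun s => (G (s - k.-1%:R * a) + kap * \1_J s)%R))).
    have Kh0 s : 0 <= \1_[set y | K y = k] s * h s by rewrite mulr_ge0// indicE.
    have GJ0 s : 0 <= G (s - k.-1%:R * a) + kap * \1_J s by rewrite addr_ge0.
    apply: (le_Lnorm p1 mKh (measurable_funD mGs mJs) Kh0 GJ0).
    apply: ae_all => s; rewrite /h [X in X * _]indicE.
    have [|_] := boolP (s \in _); last by rewrite mul0r addr_ge0.
    rewrite inE /= mul1r => Ks; rewrite indicE.
    have [|_] := boolP (s \in _); last by rewrite mul0r addr_ge0.
    rewrite inE /= in_itv /= mul1r => /andP[s0 _].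
    rewrite /f Ks /fk; apply: le_trans (rnormD _ _) _; apply: lerD.
      by rewrite /G indicE mem_set ?mul1r//= in_itv /= Kwin.
    have /andP[sk ska] := KT _ _ s0 Ks.
    have -> : \1_J s = 1 :> R.
      rewrite indicE mem_set// /J /= in_itv /= -subr_ge0 sk /=.
      by move: ska; rewrite lerBlDr -natr1 mulrDl mul1r addrC.
    rewrite mulr1 /kap; case: (k) sk => [|k'] sk; first by rewrite rnorm0.
    exact: TM.
  apply: le_trans (LnormD_le p1 mGs mJs) _.
  apply: (@le_trans _ _ ((c * B2 k)%:E + (kap * (1 + a))%:E)%E).
    apply: leeD.
      by apply: le_trans (Lnorm_shift_le _ p1 mG G0) _; exact: gB.
    have := Lnorm_indic_le p1 mJ (itv_fin _ _) kap0.
    by rewrite muJ.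
  rewrite -EFinD lee_fin /c2 mulrDl; apply: lerD.
    by rewrite -mulrA ler_wpM2l// geometric_sum2_le.
  rewrite mulrAC ler_wpM2r ?addr_ge0 ?(ltW a0)// /kap.
  case: (k) => [|k'].
    by rewrite mulr_ge0// mulr_ge0 ?(ltW M0)// mulr_ge0// mulr_ge0// mulr_ge0//
      invr_ge0 ltW.
  have -> : M * (C1 * (Q * ((1 + rho^-1) * rho^-1))) * b k'.+1 =
      M * (C1 * (Q * ((1 + rho^-1) * (rho^-1 * b k'.+1)))) by ring.
  rewrite ler_wpM2l ?(ltW M0)//.
  apply: le_trans (xP k').2 _; rewrite ler_wpM2l// ler_wpM2l//.
  apply: le_trans (geometric_sum2_le _ rho0 al0) _.
  by rewrite ler_wpM2l//; exact: geometric_sum_leS.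
have fN : (Lp_norm p t f <= (c2 / (1 - rho))%:E * Lp_norm p t u)%E.
  rewrite CnE -EFinM.
  apply: (@Lnorm_block_young _ p K h (fun s =>
    rnorm (z s)) c2 rho Cn al b (K t).+1) => //.
  - exact: measurable_rnormT.
  - by move=> s; exact: rnorm_ge0.
  - by rewrite (ltW rho0).
  - move=> s Kts; rewrite /h indicE memNset ?mul0r//= in_itv /= => /andP[_ st].
    by have := leq_trans Kts (le_time_block a0 st); rewrite ltnn.
  - by move=> k; rewrite (block_normE a0 p1 smz NC).
exists f => //; split.
  split=> //; apply: le_lt_trans fN _.
  by rewrite CnE -EFinM ltry.
have gae k : {ae mu, forall s, `[0, (2 * a)]%classic (s - k.-1%:R * a) ->
    j (g k (s - k.-1%:R * a)) = Phi S B (s - k.-1%:R * a) (window a z k)}.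
  have [[_ gae] _] := gP k.
  exact: (ae_shift (- (k.-1%:R * a)) gae).
apply: (ae_mono (ae_foralln gae)) => s sP; rewrite /= in_itv /= => /andP[s0 st].
have Ks : K s = K s by [].
have /andP[w0 w2] := Kwin _ _ s0 Ks.
have := sP (K s); rewrite /= in_itv /= w0 w2 => /(_ isT) gs.
have SM := exp_stable_bounded M0 omega0 SMe.
have ka0 (k : nat) : 0 <= k%:R * a by rewrite mulr_ge0// ltW.
have uz : Phi S B s u = Phi S B s z.
  apply: eq_Phi => r /andP[r0 rs]; rewrite /z /zero_extension asboolT//=.
  by rewrite in_itv /= r0 (le_trans rs).
have zw : Phi S B (s - (K s).-1%:R * a) (fun r => z (r + (K s).-1%:R * a)) =
    Phi S B (s - (K s).-1%:R * a) (window a z (K s)).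
  apply: eq_Phi => r /andP[r0 rs]; rewrite /window asboolT//=.
  apply: le_lt_trans (time_block_lt s a0).
  by rewrite -lerBrDr.
rewrite uz /f /fk linearD /= gs -zw.
have := Phi_split S_C0 B_bounded SM (ltW M0) CB0 BC (ka0 (K s).-1) w0 (iz _).
rewrite subrK => ->; rewrite [RHS]addrC; congr (_ + _).
have /andP[sk _] := KT _ _ s0 Ks.
case: (K s) sk {w0 w2 gs zw} => [|k] sk.
  by rewrite /= mul0r (Phi0_eq0 S_C0 B_bounded M0 omega0 CB0 SMe BC p1 smz NC)
    !linear0.
rewrite -ST// (xP k).1; have [_ _ SD _] := S_C0; rewrite -SD ?(ltW a0)//=.
by congr (S _ _); rewrite -natr1; ring.
Qed.

End Propagation.

(** * Inputs with large responses *)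

Section UniformBound.
Context {R : realType} {X Xm1 U : completeNormedModType R[i]}.
Context (S : R -> {linear Xm1 -> Xm1}).
Context (j : {linear X -> Xm1}) (B : {linear U -> Xm1}).
Context (M CB : R).
Context (S_C0 : C0_semigroup S) (B_bounded : continuous B).
Context (M0 : 0 <= M) (CB0 : 0 <= CB).
Context (SM : forall t y, 0 <= t -> rnorm (S t y) <= M * rnorm y).
Context (BC : forall v, rnorm (B v) <= CB * rnorm v).
Context (p : \bar R) (p1 : (1 <= p)%E).

Local Notation N h := (Lnorm mu p (EFin \o h)).

Lemma Lp_normZ_le (V : completeNormedModType R[i]) (t c : R) (f : R -> V) :
  strongly_measurable `[0, t]%classic f ->
  (Lp_norm p t (fun s => (c%:C *: f s)%R) <= `|c|%:E * Lp_norm p t f)%E.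
Proof.
move=> smf.
rewrite {1}/Lp_norm.
have -> : Lnorm mu p (fun s => (\1_(`[0%R,
  t]%classic) s * rnorm (c%:C *: f s)%R)%:E) =
   N (fun s => (`|c| * (\1_(`[0%R, t]%classic) s * rnorm (f s)))%R).
  by apply: eq_Lnorm => s /=; rewrite rnormZ mulrCA.
apply: LnormZ_le => //; first exact: measurable_Lp_integrand.
by move=> s; rewrite mulr_ge0 ?rnorm_ge0// indicE.
Qed.

Lemma strongly_measurableZ (V : completeNormedModType R[i]) (D : set R) (c : R)
  (f : R -> V) : strongly_measurable D f ->
  strongly_measurable D (fun s => c%:C *: f s).
Proof.
by apply: (strongly_measurable_comp (h := fun v : V => c%:C *: v));
  exact: scaler_continuous.
Qed.

Definition window_bound (eta c : R) : Prop :=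
  forall w : R -> U, in_Lp p eta w -> exists2 g, Phi_eq_in_Lq j S B p eta w g &
     (Lp_norm p eta g <= c%:E * Lp_norm p eta w)%E.

(** A violation of the bound with constant [D / e] by some [w], rescaled so
that [w] has norm [e].  Responses are only defined up to null sets, hence the
universal quantifier over [g]. *)
Lemma unbounded_window (eta D e : R) : 0 < eta -> 0 <= D -> 0 < e ->
  ~ window_bound eta (D / e) ->
  exists w, [/\ in_Lp p eta w, (Lp_norm p eta w <= e%:E)%E &
    forall g, Phi_eq_in_Lq j S B p eta w g -> (D%:E < Lp_norm p eta g)%E].
Proof.
move=> eta0 D0 e0 nb.
have [w iw wP] : exists2 w : R -> U, in_Lp p eta w & forall g,
    Phi_eq_in_Lq j S B p eta w g -> ((D / e)%:E * Lp_norm p eta w < Lp_norm p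
      eta g)%E.
  apply: contrapT => H; apply: nb => w iw; apply: contrapT => H2; apply: H.
  exists w => // g gP; rewrite ltNge; apply/negP => gle.
  by apply: H2; exists g.
have [smw woo] := iw.
pose n := fine (Lp_norm p eta w).
have nE : Lp_norm p eta w = n%:E by rewrite fineK// ge0_fin_numE ?Lnorm_ge0.
have n0 : 0 <= n by apply: fine_ge0; exact: Lnorm_ge0.
have iiw := integrable_input_Lp p1 iw.
have [nz|npos] := eqVneq n 0.
  (* a null input has a null output, which is bounded by anything *)
  have z0 : Lp_norm p eta (fun _ : R => 0 : X) = 0%E.
    rewrite -(@Lnorm0 _ _ _ (@lebesgue_measure R) p); last first.
      by rewrite gt_eqF// (lt_le_trans _ p1).
    by apply: eq_Lnorm => s /=; rewrite rnorm0 mulr0.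
  exfalso; have gz : Phi_eq_in_Lq j S B p eta w (fun _ => 0).
    split; first by split; [exact: strongly_measurable_cst|rewrite z0].
    apply: ae_all => s /=; rewrite in_itv /= => /andP[s0 se]; rewrite linear0.
    apply/esym/eqP; rewrite -rnorm_eq0 eq_le rnorm_ge0 andbT -lee_fin.
    apply: le_trans (le_Phi S_C0 B_bounded SM M0 CB0 BC (sub_integrable_input se
      iiw)) _.
    rewrite [X in (_ * X)%E](_ : _ = 0%E) ?mule0//.
    apply/eqP; rewrite eq_le; apply/andP; split; last first.
      by apply: integral_ge0 => r _; rewrite lee_fin rnorm_ge0.
    have mE : measurable_fun setT (fun s =>
      \1_(`[0, eta]%classic) s * rnorm (w s)).
      exact: measurable_Lp_integrand.
    have E0 r : 0 <= \1_(`[0, eta]%classic) r * rnorm (w r).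
      by rewrite mulr_ge0 ?rnorm_ge0// indicE.
    have := integral_le_Lnorm p1 (measurable_itv `[0, s]) (itv_fin _ _) mE E0.
    rewrite -/(Lp_norm p eta w) nE nz mule0; apply: le_trans.
    rewrite le_eqVlt; apply/orP; left; apply/eqP; apply: eq_integral => r.
    rewrite inE /= in_itv /= => /andP[r0 rs]; rewrite indicE mem_set ?mul1r//=.
    by rewrite in_itv /= r0 (le_trans rs).
  by have := wP _ gz; rewrite nE nz mule0 z0 ltxx.
pose l := e / n.
have np : 0 < n by rewrite lt_def npos.
have l0 : 0 < l by rewrite divr_gt0.
have wn : (Lp_norm p eta (fun s => (l%:C *: w s)%R) <= e%:E)%E.
  apply: le_trans (Lp_normZ_le l smw) _.
  by rewrite nE -EFinM gtr0_norm// /l divfK.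
exists (fun s => l%:C *: w s); split=> //.
  split; first exact: strongly_measurableZ.
  exact: le_lt_trans wn (ltry _).
move=> g [[smg goo] gae].
have gP : Phi_eq_in_Lq j S B p eta w (fun s => l^-1%:C *: g s).
  split; first split; first exact: strongly_measurableZ.
    apply: le_lt_trans (Lp_normZ_le l^-1 smg) _.
    by rewrite lte_mul_pinfty// lee_fin.
  apply: (ae_mono gae) => s gs s0e; rewrite linearZ /= gs//.
  move: s0e; rewrite /= in_itv /= => /andP[s0 se].
  rewrite (PhiZ S_C0 B_bounded SM M0 CB0 BC)//;
    last exact: sub_integrable_input iiw.
  by rewrite scalerA -rmorphM mulVf ?scale1r// gt_eqF.
have := lt_le_trans (wP _ gP) (Lp_normZ_le l^-1 smg).
rewrite nE -EFinM gtr0_norm ?invr_gt0// => h.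
have : (l%:E * (D / e * n)%:E < l%:E * (l^-1%:E * Lp_norm p eta g))%E.
  by rewrite lte_pmul2l// lte_fin.
rewrite muleA -!EFinM mulfV ?gt_eqF// mul1e /l.
by have -> : e / n * (D / e * n) = D by field; rewrite npos gt_eqF.
Qed.

End UniformBound.

(** * A uniform constant by gluing inputs in time *)

Section GlidingHump.
Context {R : realType} {X Xm1 U : completeNormedModType R[i]}.
Context (T : R -> {linear X -> X}) (S : R -> {linear Xm1 -> Xm1}).
Context (j : {linear X -> Xm1}) (B : {linear U -> Xm1}).
Context (M CB : R).
Context (T_C0 : C0_semigroup T) (S_C0 : C0_semigroup S)
  (B_bounded : continuous B).
Context (M0 : 0 <= M) (CB0 : 0 <= CB).
Context (TM : forall t x, 0 <= t -> rnorm (T t x) <= M * rnorm x).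
Context (SM : forall t y, 0 <= t -> rnorm (S t y) <= M * rnorm y).
Context (ST : forall t x, 0 <= t -> S t (j x) = j (T t x)).
Context (BC : forall v, rnorm (B v) <= CB * rnorm v).
Context (p : \bar R) (p1 : (1 <= p)%E).

Local Notation N h := (Lnorm mu p (EFin \o h)).

(** The window [k] is [I k = [st k, d k[] with [d k = t0 / 2 ^+ k]; its length
and that of the gap [[d k / 2, st k[] before it are both [d k / 4]. *)
Lemma admissible_window_bound :
  (forall a, 0 < a -> exists2 C, 0 < C &
    forall y, exists2 x, j x = S a y & rnorm x <= C * rnorm y) ->
  admissible j S B p p ->
  exists eta c, [/\ 0 < eta, 0 <= c & window_bound S j B p eta c].
Proof.
move=> lift [t0 t00 adm]; apply: contrapT => nb.
pose d (k : nat) := t0 / 2 ^+ k.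
have d0 k : 0 < d k by rewrite divr_gt0// exprn_gt0.
have dS k : d k.+1 = d k / 2 by rewrite /d exprS invfM mulrA mulrAC.
have dle k m : (k <= m)%N -> d m <= d k.
  move=> km; rewrite /d ler_pM2l// lef_pV2 ?posrE ?exprn_gt0//.
  by rewrite ler_weXn2l// ler1n.
have dlt k m : (k < m)%N -> d m <= d k / 2 by move=> /dle; rewrite dS.
have dt k : d k <= t0 by have := dle 0%N k isT; rewrite /d expr0 divr1.
pose st k := d k / 2 + d k / 4.
have eta0 k : 0 < d k / 4 by rewrite divr_gt0.
have stE k : st k + d k / 4 = d k by rewrite /st; field.
pose I k := `[st k, d k[%classic.
have Iuniq k m s : I k s -> I m s -> k = m.
  wlog km : k m / (k < m)%N => [H|].
    by move=> Ik Im; case: (ltngtP k m) => // /H; [exact|move=> h; apply/esym;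
      exact: h].
  rewrite /I /= !in_itv /= => /andP[h1 _] /andP[_ h2].
  by exfalso; have := dlt _ _ km; have := eta0 k; rewrite /st in h1 *; lra.
pose K s := xget 0%N [set k | I k s].
have KI k s : I k s -> K s = k.
  move=> Iks; apply: (Iuniq _ _ s) => //.
  exact: (@xgetPex _ 0%N [set k | I k s] (ex_intro _ k Iks)).
have mI k : measurable (I k) by exact: measurable_itv.
have KS k s : K s = k.+1 -> I k.+1 s.
  by rewrite /K; case: xgetP => [m -> Im <-//|_ //].
have mK k : measurable [set s | K s = k].
  case: k => [|k]; last first.
    rewrite (_ : [set s | _] = I k.+1)//.
    by apply/seteqP; split=> s /=; [exact: KS|exact: KI].
  rewrite (_ : [set s | _] = ~` \bigcup_k I k.+1).
    by apply: measurableC; apply: bigcupT_measurable => k; exact: mI.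
  apply/seteqP; split=> s /=.
    by move=> Ks [k _ /KI]; rewrite Ks.
  move=> H; case E : (K s) => [//|k]; exfalso; apply: H.
  by exists k => //; exact: KS.
have /choice[C CP] : forall k, exists C, 0 < C /\
    forall y, exists2 x, j x = S (d k / 4) y & rnorm x <= C * rnorm y.
  by move=> k; have [C C0 CP] := lift _ (eta0 k); exists C.
pose Yb := M * CB * ((1 + t0) * 2).
have Yb0 : 0 <= Yb by rewrite !mulr_ge0// addr_ge0// ltW.
(* what is added to [k] bounds the norm of the orbit that enters the window
   [k]; it depends on the gap, not on the inputs *)
pose Dk (k : nat) := k%:R + M * (C k * Yb) * (1 + t0).
have Dk0 k : 0 <= Dk k.
  by rewrite addr_ge0// mulr_ge0 ?addr_ge0 ?(ltW t00)// mulr_ge0// mulr_ge0//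
    ltW// (CP k).1.
have /choice[w wP] : forall k : nat, exists w, [/\ in_Lp p (d k / 4) w,
    (Lp_norm p (d k / 4) w <= (1 / 2 ^+ k)%:E)%E &
    forall g, Phi_eq_in_Lq j S B p (d k / 4) w g ->
      ((Dk k)%:E < Lp_norm p (d k / 4) g)%E].
  move=> k; have e0 : 0 < 1 / 2 ^+ k :> R by rewrite divr_gt0// exprn_gt0.
  apply: (@unbounded_window _ _ _ _ S j B M CB S_C0 B_bounded M0 CB0 SM BC p p1)
    => //.
  move=> wb; apply: nb; exists (d k / 4), (Dk k / (1 / 2 ^+ k)); split=> //.
  by rewrite divr_ge0// ltW.
pose u s := if `[< I (K s) s >] then w (K s) (s - st (K s)) else 0.
have uI k s : I k s -> u s = w k (s - st k).
  by move=> Iks; rewrite /u (KI _ _ Iks) asboolT.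
have u_out s : (forall k, ~ I k s) -> u s = 0 by move=> H; rewrite /u asboolF.
have smu : strongly_measurable setT u.
  apply: (strongly_measurable_glue mK) => k; rewrite setTI.
  apply: (@eq_strongly_measurable _ _ _ (fun s =>
    if `[< I k s >] then w k (s - st k) else 0)).
    by move=> s /= <-.
  apply: (strongly_measurable_if (mI k)); last exact: strongly_measurable_cst.
  have [[smw _] _ _] := wP k.
  apply: sub_strongly_measurable (strongly_measurable_shift (- st k) smw) =>
    s [_].
  rewrite /I /= !in_itv /= subr_ge0 => /andP[-> /= h].
  by rewrite lerBlDr addrC stE ltW.
have mnu : measurable_fun setT (fun s =>
  rnorm (u s)) by exact: measurable_rnormT.
have N2 : (N (fun s => rnorm (u s)) <= 2%:E)%E.
  rewrite -[2]mulr1; apply: (Lnorm_geometric_le p1 mK) => //.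
    by move=> s; exact: rnorm_ge0.
  move=> k; have [[smw _] wk _] := wP k.
  pose G r := \1_(`[0, d k / 4]%classic) r * rnorm (w k r).
  have mG : measurable_fun setT G by exact: measurable_Lp_integrand.
  have G0 r : 0 <= G r by rewrite mulr_ge0 ?rnorm_ge0// indicE.
  apply: le_trans wk; apply: le_trans (Lnorm_shift_le (- st k) p1 mG G0).
  have ms : measurable_fun setT (fun s : R =>
    s - st k) by exact: measurable_funB.
  have mGs : measurable_fun setT (fun s : R =>
    G (s - st k)) by exact: (measurableT_comp mG ms).
  have mL : measurable_fun setT (fun s : R =>
    \1_[set y | K y = k] s * rnorm (u s)).
    exact: measurable_restrict_indic.
  have L0 s : 0 <= \1_[set y | K y = k] s * rnorm (u s).
    by rewrite mulr_ge0 ?rnorm_ge0// indicE.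
  apply: (le_Lnorm p1 mL mGs L0 _) => //.
  apply: ae_all => s; have [Iks|nIks] := pselect (I k s).
    have J1 : \1_(`[0, d k / 4]%classic) (s - st k) = 1 :> R.
      rewrite indicE mem_set//=; move: Iks.
      rewrite /I /= !in_itv /= subr_ge0 => /andP[-> /= h].
      by rewrite lerBlDr addrC stE ltW.
    rewrite (uI _ _ Iks) /G J1 mul1r ler_piMl ?rnorm_ge0// indicE.
  have [Ks|Ks] := pselect (K s = k).
    by rewrite /u Ks asboolF// rnorm0 mulr0.
  by rewrite indicE memNset// mul0r.
have iu r : integrable_input r u by exact: integrable_input_global p1 smu N2.
have iut0 : in_Lp p t0 u.
  split; first exact: sub_strongly_measurable smu.
  apply: le_lt_trans (ltry 2); apply: le_trans N2.
  apply: le_Lnorm => //.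
  - by apply: measurable_Lp_integrand => //; exact: sub_strongly_measurable smu.
  - by move=> s; rewrite mulr_ge0 ?rnorm_ge0// indicE.
  - by move=> s; exact: rnorm_ge0.
  - apply: ae_all => s; rewrite ler_piMl ?rnorm_ge0// indicE.
have [f [[smf foo] fae]] := adm _ iut0.
pose F := fine (Lp_norm p t0 f).
have FE : Lp_norm p t0 f = F%:E by rewrite fineK// ge0_fin_numE ?Lnorm_ge0.
(* taking [k] above [F] contradicts the choice of the [w k] *)
suff H k : (Dk k < F + M * (C k * Yb) * (1 + t0)).
  have := H (Num.truncn F).+1; rewrite /Dk ltrD2r.
  by apply/negP; rewrite -leNgt ltW// -truncn_le_nat.
have [Ck0 Ck] := CP k; have [[smw _] _ wbig] := wP k.
pose y := Phi S B (d k / 2) u.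
have yb : rnorm y <= Yb.
  rewrite -lee_fin; apply: le_trans (le_Phi S_C0 B_bounded SM M0 CB0 BC (iu _))
    _.
  rewrite /Yb [in leRHS]EFinM; apply: lee_wpmul2l;
    first by rewrite lee_fin mulr_ge0.
  apply: le_trans (integral_le_Lnorm p1 (measurable_itv _) (itv_fin _ _) mnu _)
    _.
    by move=> s; exact: rnorm_ge0.
  have -> : mu `[0, (d k / 2)]%classic = (d k / 2)%:E.
    by rewrite lebesgue_measure_itv /= lte_fin divr_gt0// sube0.
  rewrite -EFinD EFinM; apply: lee_pmul => //;
    first by rewrite lee_fin addr_ge0// divr_ge0// ltW.
  exact: Lnorm_ge0.
  by rewrite lee_fin lerD2l; have := dt k; have := d0 k; lra.
have [x jx xb] := Ck y.
(* no input acts during the gap, so the earlier inputs are smoothed by [S] *)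
have gap : Phi S B (st k) u = S (d k / 4) y.
  have -> : st k = d k / 4 + d k / 2 by rewrite /st addrC.
  have h2 : 0 <= d k / 2 by rewrite divr_ge0// ltW.
  rewrite (Phi_split S_C0 B_bounded SM M0 CB0 BC h2 (ltW (eta0 k)) (iu _)).
  rewrite [X in _ + X](_ : _ = 0) ?addr0//.
  apply/eqP; rewrite -rnorm_eq0 eq_le rnorm_ge0 andbT -lee_fin.
  have ish := integrable_input_shift h2 (ltW (eta0 k)) (iu (d k / 4 + d k / 2)).
  apply: le_trans (le_Phi S_C0 B_bounded SM M0 CB0 BC ish) _.
  rewrite [X in (_ * X)%E](_ : _ = 0%E) ?mule0//.
  have sub : `[0, (d k / 4)[%classic `<=` `[0, (d k / 4)]%classic.
    by move=> s /=; rewrite !in_itv /= => /andP[-> /ltW].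
  rewrite -integral_itv_bndo_bndc; last first.
    apply/measurable_EFinP; apply: measurable_rnorm.
    exact: sub_strongly_measurable sub ish.1.
  apply: integral0_eq => s /=; rewrite in_itv /= => /andP[s0 s1].
  rewrite u_out ?rnorm0// => m; rewrite /I /= in_itv /= => /andP[h3 h4].
  case: (ltngtP k m) => [km|mk|km].
  - by have := dlt _ _ km; lra.
  - by have := dlt _ _ mk; have := eta0 m; rewrite /st in h3; lra.
  - by rewrite -km /st in h3; lra.
(* [g] is a response to [w k], and it is too small *)
pose g r := f (r + st k) - T r x.
have smg : strongly_measurable `[0, (d k / 4)]%classic g.
  apply: strongly_measurableB.
    apply: sub_strongly_measurable (strongly_measurable_shift (st k) smf) =>
      s /=.
    rewrite !in_itv /= => /andP[s0 s1]; rewrite addr_ge0//=.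
      by apply: le_trans (dt k); rewrite -(stE k) addrC lerD2l.
    by rewrite /st addr_ge0// divr_ge0// ltW.
  apply: (strongly_measurable_semigroup T_C0 TM) => //.
  - by move=> s /=; rewrite in_itv /= => /andP[].
  - exact: strongly_measurable_cst.
have gN : (Lp_norm p (d k / 4) g <= (F + M * (C k * Yb) * (1 + t0))%:E)%E.
  pose G r := \1_(`[0, t0]%classic) r * rnorm (f r).
  have mG : measurable_fun setT G by exact: measurable_Lp_integrand.
  have G0 r : 0 <= G r by rewrite mulr_ge0 ?rnorm_ge0// indicE.
  pose J := `[0, (d k / 4)]%classic.
  have mJ : measurable J by exact: measurable_itv.
  have muJ : fine (mu J) = d k / 4.
    by rewrite lebesgue_measure_itv /= lte_fin eta0 -EFinB subr0.
  have kap0 : 0 <= M * (C k * Yb) by rewrite mulr_ge0// mulr_ge0// ltW.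
  have ms : measurable_fun setT (fun s : R =>
    s + st k) by exact: measurable_funD.
  have mGs : measurable_fun setT (fun s : R =>
    G (s + st k)) by exact: (measurableT_comp mG ms).
  have mI' : measurable_fun setT (\1_J : R -> R) by exact: measurable_indic.
  have mJs : measurable_fun setT (fun s : R =>
    M * (C k * Yb) * \1_J s) by exact: measurable_funM.
  have GJ0 s : 0 <= G (s + st k) + M * (C k * Yb) * \1_J s.
    by rewrite addr_ge0// mulr_ge0// indicE.
  have mg := measurable_Lp_integrand mJ smg.
  have g0 s : 0 <= \1_J s * rnorm (g s) by rewrite mulr_ge0 ?rnorm_ge0// indicE.
  apply: le_trans (le_Lnorm p1 mg (measurable_funD mGs mJs) g0 GJ0 _) _.
    apply: ae_all => s; have [Js|nJs] := pselect (J s); last first.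
      have J00 : \1_J s = 0 :> R by rewrite indicE memNset.
      by rewrite J00 mul0r; exact: GJ0.
    have J1 : \1_J s = 1 :> R by rewrite indicE mem_set.
    rewrite /= J1 mul1r mulr1; apply: le_trans (rnormB _ _) _.
    move: Js; rewrite /J /= in_itv /= => /andP[s0 s1]; apply: lerD.
      rewrite /G indicE mem_set ?mul1r//= in_itv /= addr_ge0//=; last first.
        by rewrite /st addr_ge0// divr_ge0// ltW.
      by apply: le_trans (dt k); rewrite -(stE k) addrC lerD2l.
    apply: le_trans (TM _ s0) _; rewrite ler_wpM2l//.
    by apply: le_trans xb _; rewrite ler_pM2l.
  apply: le_trans (LnormD_le p1 mGs mJs) _; rewrite EFinD; apply: leeD.
    by apply: le_trans (Lnorm_shift_le _ p1 mG G0) _; rewrite -FE.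
  apply: le_trans (Lnorm_indic_le p1 mJ (itv_fin _ _) kap0) _.
  rewrite muJ lee_fin ler_wpM2l// lerD2l; have := dt k; have := d0 k; lra.
rewrite -lte_fin; apply: lt_le_trans (gN); apply: wbig; split.
  by split=> //; apply: le_lt_trans gN (ltry _).
have gae := ae_shift (st k) fae.
have etaN : {ae mu, forall s, s <> d k / 4}.
  exists [set d k / 4]; split; [exact: measurable_set1|exact:
    lebesgue_measure_set1|].
  by move=> s /= /contrapT.
apply: (ae_mono2 gae etaN) => s fs sneq; rewrite /= in_itv /= => /andP[s0 s1].
have {}s1 : s < d k / 4 by rewrite lt_neqAle s1 andbT; exact/eqP.
have st0 : 0 <= st k by rewrite /st addr_ge0// divr_ge0// ltW.
rewrite /g linearB /= fs /=; last first.
  rewrite in_itv /= addr_ge0//=.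
  by apply: le_trans (dt k); rewrite -(stE k) addrC lerD2l ltW.
rewrite (Phi_split S_C0 B_bounded SM M0 CB0 BC st0 s0 (iu _))
  gap -jx ST// addrAC subrr add0r.
apply: eq_Phi => r /andP[r0 rs]; rewrite (uI k) ?addrK//.
rewrite /I /= in_itv /= lerDr r0 /= -[ltRHS](stE k) addrC ltrD2l.
exact: le_lt_trans s1.
Qed.

End GlidingHump.

(** * The equivalence *)

Theorem theorem2p13 (R : realType) (X Xm1 U : completeNormedModType R[i])
    (T : R -> {linear X -> X}) (A : @unbounded_operator R X)
    (lambda : R[i]) (Rl : {linear X -> X})
    (j : {linear X -> Xm1}) (Tm1 : R -> {linear Xm1 -> Xm1})
    (B : {linear U -> Xm1}) (p : \bar R)
    (T_C0 : C0_semigroup T)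
    (A_gen : is_generator T A)
    (lambda_res : is_resolvent A lambda Rl)
    (Xm1_extrapolation : is_extrapolation T Rl j Tm1)
    (B_bounded : continuous B)
    (T_stable : exponentially_stable T)
    (T_analytic : analytic_semigroup T)
    (p_ge1 : (1 <= p)%E) :
  admissible j Tm1 B p p <-> infinite_time_admissible j Tm1 B p p.
Proof.
split=> [adm|[]//]; split=> //.
have [M [omega [M0 omega0 TMe]]] := T_stable.
have [CB CB0 BC] := continuous_linear_rnorm B_bounded.
have [_ _ S_C0 ST] := Xm1_extrapolation.
have SMe := extrapolated_semigroup_le T_C0 A_gen lambda_res Xm1_extrapolation M0
  TMe.
have TM := exp_stable_bounded M0 omega0 TMe.
have SM := exp_stable_bounded M0 omega0 SMe.
have lift a : 0 < a -> exists2 C, 0 < C &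
    forall y, exists2 x, j x = Tm1 a y & rnorm x <= C * rnorm y.
  move=> a0; have [C C0 TC] :=
    analytic_smoothing T_C0 A_gen lambda_res Xm1_extrapolation T_analytic a0.
  exists C => //; exact: (smoothing_lift lambda_res Xm1_extrapolation (ltW a0)
    C0 TC).
have [eta [c [eta0 c0 win]]] := admissible_window_bound T_C0 S_C0 B_bounded
  (ltW M0) (ltW CB0) TM SM ST BC p_ge1 lift adm.
have a0 : 0 < eta / 2 by rewrite divr_gt0.
have [C1 C10 lift1] := lift _ a0.
apply: (infinite_time_of_window T_C0 S_C0 B_bounded M0 omega0 (ltW CB0)
  TM SMe ST
  BC p_ge1 a0 c0 (ltW C10) lift1).
by have -> : 2 * (eta / 2) = eta by field.
Qed.
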